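(* Let $(J_1,\mu_1,W_1)$ and $(J_2,\mu_2,W_2)$ be two pure kernels. If $t(H,W_1)=t(H,W_2)$ for every $H\in\mathcal{H}$, then there exists an isometry $\rho:(J_1,d_{W_1})\to(J_2,d_{W_2})$ such that $\rho$ and $\rho^{-1}$ are measure preserving, and $W_1$ and $W_2^{\rho}$ are equal $\mu_1^3$-almost everywhere.
   Context: A kernel is a triple $(J,\mu,W)$ where $(J,\mu)$ is a probability space and $W:J^3\to\mathbb{R}$ is measurable and bounded. Its neighborhood pseudo-distance is $d_W(x,x')=\int_{J^2}|W(x,y,z)-W(x',y,z)|\,d\mu(y)\,d\mu(z)$. The kernel is pure if $d_W$ is a distance on $J$, the metric space $(J,d_W)$ is complete and separable, and every non-empty open set of $(J,d_W)$ has positive $\mu$-measure. For $n\ge1$ let $\mathcal{H}_n$ be the set of functions $[n]^3\to\mathbb{R}$ and $\mathcal{H}=\bigcup_n\mathcal{H}_n$. For $S=(x_1,\dots,x_n)\in J^n$, $\mathbf{H}(W,S)(i,j,k)=W(x_i,x_j,x_k)$; for $H\in\mathcal{H}_n$, $t(H,W)$ is the probability that $\mathbf{H}(W,S)=H$ for $S$ drawn from $\mu^n$. A map $\phi$ between probability spaces is measure preserving if preimages of measurable sets are measurable with the same measure. $W^{\rho}(x,y,z)=W(\rho(x),\rho(y),\rho(z))$.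
   Formalization: Instead of t(H,W1)=t(H,W2) for each H, the arrays H(W1,S), H(W2,S) are assumed to have the same law for every n (with W=x and x/2 on [0,1] all t(H,W) vanish; equivalent for countably many values); and a pure kernel's measurable sets are assumed to be the Borel sets of d_W. *)

(* Defs.v *)
(* MathComp-Analysis *)
From HB Require Import structures.
From mathcomp Require Import all_boot all_order all_algebra.
From mathcomp Require Import all_classical all_reals all_analysis.
From mathcomp Require Import measurable_realfun.
Set Implicit Arguments.
Unset Strict Implicit.
Unset Printing Implicit Defensive.
Import Order.TTheory GRing.Theory Num.Theory.
Import numFieldNormedType.Exports.
Local Open Scope classical_set_scope.
Local Open Scope ring_scope.

Record ternary_kernel d (J : measurableType d) (R : realType) := Kernel {
  kmu : probability J R;
  kfun :> J * J * J -> R;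
  kfun_measurable : measurable_fun [set: J * J * J] kfun;
  kfun_bounded : [bounded kfun p | p in [set: J * J * J]] }.

Section NeighborhoodDistance.
Context d (J : measurableType d) (R : realType) (K : ternary_kernel J R).
Local Notation mu := (kmu K).

Definition ndist (x x' : J) : R :=
  \int[(mu \x mu)%E]_p `|K (x, p.1, p.2) - K (x', p.1, p.2)|.

Lemma ndist_integrable (x x' : J) :
  (mu \x mu)%E.-integrable setT
    (EFin \o (fun p => `|K (x, p.1, p.2) - K (x', p.1, p.2)|)).
Proof.
have mK a : measurable_fun [set: J * J] (fun p => K (a, p.1, p.2)).
  apply: measurableT_comp; first exact: kfun_measurable.
  by apply: measurable_fun_pair => //; apply: measurable_fun_pair.
apply: measurable_bounded_integrable => //.
- by rewrite (le_lt_trans (probability_le1 _ _))// ltry.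
- exact/measurableT_comp/measurable_funB.
have [M [_ hM]] := kfun_bounded K.
exists (2 * (M + 1)); split; first by rewrite num_real.
move=> y hy p _ /=; rewrite normr_id; apply: le_trans (ltW hy).
rewrite mulr_natl mulr2n; apply: (le_trans (ler_normB _ _)).
by apply: lerD; apply: hM => //; rewrite ltrDl.
Qed.

Lemma ndistxx (x : J) : ndist x x = 0.
Proof.
rewrite /ndist; under eq_Rintegral do rewrite subrr normr0.
by rewrite Rintegral_cst// mul0r.
Qed.

Lemma ndist_sym (x y : J) : ndist x y = ndist y x.
Proof. by rewrite /ndist; under eq_Rintegral do rewrite distrC. Qed.

Lemma ndist_triangle (y x z : J) : ndist x z <= ndist x y + ndist y z.
Proof.
rewrite /ndist -RintegralD//; try exact: ndist_integrable.
apply: le_Rintegral => //; first exact: ndist_integrable.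
- exact: (integrableD _ (ndist_integrable _ _) (ndist_integrable _ _)).
- by move=> p _; exact: ler_distD.
Qed.

End NeighborhoodDistance.

(* J with the topology and uniformity of the pseudo-distance ndist K *)
Definition nspace d (J : measurableType d) (R : realType) (K : ternary_kernel J R) : Type := J.

Section NeighborhoodSpace.
Context d (J : measurableType d) (R : realType) (K : ternary_kernel J R).
Local Notation nspace := (nspace K).
Local Notation ndist := (ndist K).

HB.instance Definition _ := Choice.copy nspace J.
HB.instance Definition _ := isPointed.Build nspace (point : J).

Let ball (x : nspace) (e : R) : set nspace := [set y | ndist x y < e].
Let ent : set_system (nspace * nspace) := entourage_ ball.
Let nbhs (x : nspace) : set_system nspace := nbhs_ ent x.
Let nbhsE : nbhs = nbhs_ ent. Proof. by []. Qed.

HB.instance Definition _ := hasNbhs.Build nspace nbhs.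

Let ball_center x (e : R) : 0 < e -> ball x e x.
Proof. by move=> e0; rewrite /ball/= ndistxx. Qed.

Let ball_sym x y (e : R) : ball x e y -> ball y e x.
Proof. by rewrite /ball/= ndist_sym. Qed.

Let ball_triangle x y z (e1 e2 : R) :
  ball x e1 y -> ball y e2 z -> ball x (e1 + e2) z.
Proof.
rewrite /ball/= => xy yz.
by rewrite (le_lt_trans (ndist_triangle K y _ _))// ltrD.
Qed.

Let entE : ent = entourage_ ball. Proof. by []. Qed.

HB.instance Definition _ := @Nbhs_isPseudoMetric.Build R nspace
  ent nbhsE ball ball_center ball_sym ball_triangle entE.

End NeighborhoodSpace.

(* The other axioms of a distance hold for every kernel (ndistxx, ndist_sym,
   ndist_triangle).  The last clause makes the measure a Borel measure on the
   metric space.  Open sets are measurable anyway, by Fubini and separability;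
   without the converse inclusion, J could carry events invisible to the
   metric: the Borel and the Lebesgue sigma-algebras on [0, 1] would give
   distinct pure kernels with the same W. *)
Definition pure_kernel d (J : measurableType d) (R : realType) (K : ternary_kernel J R) : Prop :=
  [/\ forall x y : J, ndist K x y = 0 -> x = y,
      forall F : set_system (nspace K), ProperFilter F -> cauchy F -> cvg F,
      exists2 S : set (nspace K), countable S & dense S,
      forall U : set (nspace K), open U -> U !=set0 -> (0 < kmu K U)%E &
      (measurable : set (set J)) = <<s (open : set (set (nspace K))) >>].

Section Sampling.
Context d (J : measurableType d) (R : realType).

Definition tcons n (p : J * n.-tuple J) : n.+1.-tuple J := [tuple of p.1 :: p.2].

Lemma measurable_tcons n : measurable_fun [set: J * n.-tuple J] (@tcons n).
Proof. exact: measurable_cons. Qed.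

HB.instance Definition _ n :=
  isMeasurableFun.Build _ _ _ _ (@tcons n) (@measurable_tcons n).

(* the product measure mu^n, i.e. the law of n independent mu-random points *)
Fixpoint power_prob (mu : probability J R) n : probability (n.-tuple J) R :=
  match n with
  | 0 => \d_[tuple]
  | m.+1 => distribution (mu \x power_prob mu m)%E (@tcons m)
  end.

Definition array n := 'I_n * 'I_n * 'I_n -> R.

(* the product sigma-algebra, generated by the coordinates *)
Definition array_measurable n : set (set (array n)) :=
  <<s \bigcup_(p in [set: 'I_n * 'I_n * 'I_n])
        preimage_set_system setT (fun H : array n => H p) measurable >>.

Definition sample_array (K : ternary_kernel J R) n (S : n.-tuple J) : array n :=
  fun p => K (tnth S p.1.1, tnth S p.1.2, tnth S p.2).

Definition sample_law (K : ternary_kernel J R) n (A : set (array n)) : \bar R :=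
  power_prob (kmu K) n [set S | A (sample_array K S)].

Definition point_prob n (H : array n) (K : ternary_kernel J R) : \bar R :=
  sample_law K [set H].

Lemma sample_array_measurable (K : ternary_kernel J R) n (p : 'I_n * 'I_n * 'I_n) :
  measurable_fun setT (fun S : n.-tuple J => sample_array K S p).
Proof.
apply: (measurableT_comp (kfun_measurable K)).
apply: measurable_fun_pair; last exact: measurable_tnth.
by apply: measurable_fun_pair; exact: measurable_tnth.
Qed.

Lemma measurable_sample_eq (K : ternary_kernel J R) n (H : array n) :
  measurable [set S : n.-tuple J | sample_array K S = H].
Proof.
have -> : [set S : n.-tuple J | sample_array K S = H] =
    \bigcap_(p in [set: 'I_n * 'I_n * 'I_n])
      ([set: n.-tuple J] `&` (fun S => sample_array K S p) @^-1` [set H p]).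
  apply/seteqP; split => S /=; first by move=> <- p _; split.
  by move=> h; apply/funext => p; have [] := h p I.
apply: fin_bigcap_measurable; first exact: finite_finset.
by move=> p _; exact: sample_array_measurable.
Qed.

End Sampling.

(* The random arrays H(K1, S) and H(K2, S) have the same law, for every sample
   size n >= 1.  Equality of the probabilities of the single arrays would not be
   enough for kernels with a diffuse law: for W(x, y, z) = x and x / 2 on [0, 1]
   all of them vanish.  It is enough, hence equivalent, for kernels with
   countably many values (same_sampling_countableP). *)
Definition same_sampling d1 d2 (J1 : measurableType d1) (J2 : measurableType d2)
    (R : realType) (K1 : ternary_kernel J1 R) (K2 : ternary_kernel J2 R) : Prop :=
  forall n, (0 < n)%N -> forall A : set (array R n),
    array_measurable A -> sample_law K1 A = sample_law K2 A.

Lemma array_measurable1 (R : realType) n (H : array R n) :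
  array_measurable [set H].
Proof.
pose G := \bigcup_(p in [set: 'I_n * 'I_n * 'I_n])
  preimage_set_system setT (fun H : array R n => H p) measurable.
suff : @measurable _ (g_sigma_algebraType G) [set H] by [].
have -> : [set H] = \bigcap_(p in [set: 'I_n * 'I_n * 'I_n])
    ([set: array R n] `&` (fun H => H p) @^-1` [set H p]).
  apply/seteqP; split => S /=; first by move=> -> p _; split.
  by move=> h; apply/funext => p; have [] := h p I.
apply: fin_bigcap_measurable; first exact: finite_finset.
move=> p _; apply: sub_sigma_algebra; exists p => //.
by exists [set H p].
Qed.

Lemma countable_arrays (R : realType) n (V : set R) :
  countable V -> countable [set H : array R n | forall p, V (H p)].
Proof.
move=> /countable_injP[f fV]; apply/countable_injP.
exists (fun H => pickle [seq f (H p) | p <- enum [set: 'I_n * 'I_n * 'I_n]%SET]).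
move=> H H'; rewrite !inE => VH VH' /(pcan_inj pickleK) /eq_in_map e.
by apply/funext => p; apply: fV; rewrite ?inE//; apply: e; rewrite mem_enum inE.
Qed.

Lemma same_sampling_countableP d1 d2 (J1 : measurableType d1)
    (J2 : measurableType d2) (R : realType)
    (K1 : ternary_kernel J1 R) (K2 : ternary_kernel J2 R) :
  countable (range K1) -> countable (range K2) ->
  same_sampling K1 K2 <->
  (forall n, (0 < n)%N -> forall H : array R n, point_prob H K1 = point_prob H K2).
Proof.
move=> c1 c2; split=> [h n n0 H|h n n0 A _].
  by apply: h => //; exact: array_measurable1.
pose V := range K1 `|` range K2.
have cV : countable V by rewrite /V -bigcup2E; apply: bigcup_countable => // -[|[|]].
pose D := [set H : array R n | forall p, V (H p)].
have /countable_injP[g gD] : countable D by exact: countable_arrays.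
pose B k := [set H : array R n | [/\ D H, A H & g H = k]].
have BE k : B k = set0 \/ exists H, B k = [set H].
  have [->|/set0P[H [DH AH gH]]] := eqVneq (B k) set0; [by left|right].
  exists H; apply/seteqP; split => [H' [DH' AH' gH']|H' ->]//=.
  by apply: gD; rewrite ?inE// gH.
have lawE d (J : measurableType d) (K : ternary_kernel J R) : range K `<=` V ->
    sample_law K A = (\sum_(k <oo) sample_law K (B k))%E.
  move=> KV; rewrite /sample_law.
  have -> : [set S | A (sample_array K S)] =
      \bigcup_k [set S | B k (sample_array K S)].
    apply/seteqP; split => [S /= AS|S [k _ []]//].
    exists (g (sample_array K S)) => //; split=> // p; apply: KV.
    by exists (tnth S p.1.1, tnth S p.1.2, tnth S p.2).
  rewrite measure_bigcup//.
  - by apply: congr_lim; apply/funext => m; apply: eq_bigl => i; rewrite in_setT.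
  - move=> k _; have [->|[H ->]] := BE k; first exact: measurable0.
    exact: measurable_sample_eq.
  - by move=> i j _ _ [S [[_ _ <-] [_ _ <-]]].
rewrite !lawE; [|by move=> x; right|by move=> x; left].
apply: eq_eseriesr => k _; have [->|[H ->]] := BE k; last exact: h.
transitivity (0%E : \bar R); first exact: measure0.
by apply: esym; exact: measure0.
Qed.

Definition measure_preserving d1 d2 (T1 : measurableType d1)
    (T2 : measurableType d2) (R : realType) (m1 : probability T1 R)
    (m2 : probability T2 R) (f : T1 -> T2) : Prop :=
  forall A, measurable A -> measurable (f @^-1` A) /\ m1 (f @^-1` A) = m2 A.

Definition pullback T1 T2 (R : Type) (rho : T1 -> T2) (W : T2 * T2 * T2 -> R) :
  T1 * T1 * T1 -> R := fun p => W (rho p.1.1, rho p.1.2, rho p.2).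

(* Main.v *)
(* Call f1 on J1^n and f2 on J2^n a definable pair if they are uniform limits of
   one and the same "polynomial", i.e. linear combination of integrals, over
   additional sampled points, of products of entries of W1, resp. W2.  Definable
   pairs are closed under sums, products, integration of a variable and, since
   |v| is a uniform limit of polynomials in v, under absolute values, min and
   max.  The sampling laws determine the values of the polynomials without free
   variable, so closed definable expressions agree in both kernels.

   Two n-tuples are matched if all definable pairs, whose free variables occur
   only in the first position of W, agree on them.  Such functions are
   continuous for d_W.  If x1 and x2 are matched, any ball of J1 contains some y1
   such that (x1, y1) is matched to (x2, y2) for some y2: otherwise, by
   compactness, a definable function vanishes on a compact part of positive
   measure of the ball and equals 1 on a compact set of nearly full measure of
   J2 (Ulam), although its integrals in both kernels coincide.  This yields, by
   back-and-forth, dense sequences in J1 and J2 all of whose initial segments are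
   matched.  The distances, and the integrals of W against products of indicators
   of finite intersections of balls centered at the sequence, are limits of
   definable functions of the sequence, hence correspond; the isometry extends by
   completeness, and a pi-lambda argument gives the measure statements. *)

Require Import Defs.
From HB Require Import structures.
From mathcomp Require Import all_boot all_order all_algebra.
From mathcomp Require Import all_classical all_reals all_analysis.
From mathcomp Require Import measurable_realfun.
From mathcomp Require Import lra ring zify.
Set Implicit Arguments.
Unset Strict Implicit.
Unset Printing Implicit Defensive.
Import Order.TTheory GRing.Theory Num.Theory.
Import numFieldNormedType.Exports.
Local Open Scope classical_set_scope.
Local Open Scope ring_scope.

(** * Bounded measurable functions *)

Section BoundedMeasurable.
Context {R : realType}.

(** Unlike integrability, this property is stable under products. Over a probability measure it
    implies integrability and suffices for Fubini's theorem. *)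
Definition bounded_measurable d (T : measurableType d) (f : T -> R) :=
  measurable_fun setT f /\ exists M : R, forall x, `|f x| <= M.

Section Closure.
Context d (T : measurableType d).
Implicit Types f g : T -> R.

Lemma bmeas_cst (c : R) : bounded_measurable (fun _ : T => c).
Proof. by split; [exact: measurable_cst|exists `|c|]. Qed.

Lemma bmeasD f g : bounded_measurable f -> bounded_measurable g ->
  bounded_measurable (fun x => f x + g x).
Proof.
move=> [mf [M fM]] [mg [N gN]]; split; first exact: measurable_funD.
by exists (M + N) => x; rewrite (le_trans (ler_normD _ _))// lerD.
Qed.

Lemma bmeasM f g : bounded_measurable f -> bounded_measurable g ->
  bounded_measurable (fun x => f x * g x).
Proof.
move=> [mf [M fM]] [mg [N gN]]; split; first exact: measurable_funM.
by exists (M * N) => x; rewrite normrM ler_pM.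
Qed.

Lemma bmeasB f g : bounded_measurable f -> bounded_measurable g ->
  bounded_measurable (fun x => f x - g x).
Proof.
move=> [mf [M fM]] [mg [N gN]]; split; first exact: measurable_funB.
by exists (M + N) => x; rewrite (le_trans (ler_normB _ _))// lerD.
Qed.

Lemma bmeas_abs f : bounded_measurable f -> bounded_measurable (fun x => `|f x|).
Proof.
move=> [mf [M fM]]; split; first exact: measurableT_comp.
by exists M => x; rewrite normr_id.
Qed.

Lemma bmeas_comp d' (T' : measurableType d') (h : T' -> T) f :
  measurable_fun setT h -> bounded_measurable f ->
  bounded_measurable (fun x => f (h x)).
Proof.
by move=> mh [mf [M fM]]; split; [exact: measurableT_comp|exists M].
Qed.

Lemma bmeas_prod (A : Type) (s : seq A) (h : A -> T -> R) :
  (forall a, bounded_measurable (h a)) ->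
  bounded_measurable (fun x => \prod_(a <- s) h a x).
Proof.
move=> bh; elim: s => [|a s IH].
  rewrite (_ : (fun x => _) = cst 1); first exact: bmeas_cst.
  by apply/funext => x; rewrite big_nil.
rewrite (_ : (fun x => _) = fun x => h a x * \prod_(b <- s) h b x).
  exact: bmeasM.
by apply/funext => x; rewrite big_cons.
Qed.

Lemma bmeas_indic (A : set T) : measurable A -> bounded_measurable (\1_A : T -> R).
Proof.
move=> mA; split; first exact: measurable_indic.
by exists 1 => x; rewrite indicE; case: (_ \in _); rewrite ?normr1 ?normr0.
Qed.

End Closure.

Section Integral.
Context d (T : measurableType d) (mu : probability T R).
Implicit Types f g : T -> R.

Lemma bmeas_integrable f : bounded_measurable f ->
  mu.-integrable setT (EFin \o f).
Proof.
move=> [mf [M fM]]; apply: measurable_bounded_integrable => //.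
  by rewrite (le_lt_trans (probability_le1 _ _))// ltry.
exists M; split; first by rewrite num_real.
by move=> y My x _ /=; rewrite (le_trans (fM x))// ltW.
Qed.

Lemma RintegralT_cst (c : R) : \int[mu]_x c = c.
Proof. by rewrite Rintegral_cst//= probability_setT/= mulr1. Qed.

Lemma bmeas_EFin f : bounded_measurable f ->
  (\int[mu]_x f x)%:E = (\int[mu]_x (f x)%:E)%E.
Proof.
by move=> bf; rewrite /Rintegral fineK//; exact: integrable_fin_num (bmeas_integrable bf).
Qed.

Lemma bmeas_RintegralD f g : bounded_measurable f -> bounded_measurable g ->
  \int[mu]_x (f x + g x) = \int[mu]_x f x + \int[mu]_x g x.
Proof. by move=> bf bg; rewrite RintegralD//; exact: bmeas_integrable. Qed.

Lemma bmeas_RintegralB f g : bounded_measurable f -> bounded_measurable g ->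
  \int[mu]_x (f x - g x) = \int[mu]_x f x - \int[mu]_x g x.
Proof. by move=> bf bg; rewrite RintegralB//; exact: bmeas_integrable. Qed.

Lemma bmeas_RintegralZl f c : bounded_measurable f ->
  \int[mu]_x (c * f x) = c * \int[mu]_x f x.
Proof. by move=> bf; rewrite RintegralZl//; exact: bmeas_integrable. Qed.

Lemma bmeas_RintegralZr f c : bounded_measurable f ->
  \int[mu]_x (f x * c) = (\int[mu]_x f x) * c.
Proof. by move=> bf; rewrite RintegralZr//; exact: bmeas_integrable. Qed.

Lemma bmeas_le f g : bounded_measurable f -> bounded_measurable g ->
  (forall x, f x <= g x) -> \int[mu]_x f x <= \int[mu]_x g x.
Proof. by move=> bf bg fg; apply: le_Rintegral => //; exact: bmeas_integrable. Qed.

Lemma bmeas_norm_le f M : bounded_measurable f -> (forall x, `|f x| <= M) ->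
  `|\int[mu]_x f x| <= M.
Proof.
move=> bf fM; apply: le_trans (le_normr_Rintegral _ (bmeas_integrable bf)) _ => //.
rewrite -[leRHS](RintegralT_cst M); apply: bmeas_le => //; first exact: bmeas_abs.
exact: bmeas_cst.
Qed.

Lemma bmeas_dist_le f g e : bounded_measurable f -> bounded_measurable g ->
  (forall x, `|f x - g x| <= e) -> `|\int[mu]_x f x - \int[mu]_x g x| <= e.
Proof.
by move=> bf bg fg; rewrite -bmeas_RintegralB//; apply: bmeas_norm_le => //; exact: bmeasB.
Qed.

Lemma Rintegral_indicT (A : set T) : measurable A ->
  (\int[mu]_x (\1_A x : R))%:E = mu A.
Proof.
by move=> mA; rewrite bmeas_EFin ?integral_indic ?setIT//; exact: bmeas_indic.
Qed.

(** The measure is finite, so a constant dominates; the bound passes to the limit. *)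
Lemma bmeas_dominated (f_ : nat -> T -> R) f (M : R) :
  (forall n, measurable_fun setT (f_ n)) -> (forall n x, `|f_ n x| <= M) ->
  (forall x, f_ ^~ x @ \oo --> f x) ->
  bounded_measurable f /\ (fun n => \int[mu]_x f_ n x) @ \oo --> \int[mu]_x f x.
Proof.
move=> mf_ fM cf.
have mf : measurable_fun setT f.
  by apply: (measurable_fun_cvg mf_) => x _; exact: cf.
have bf : bounded_measurable f.
  split => //; exists M => x.
  have cfx : (fun n => `|f_ n x|) @ \oo --> `|f x|.
    by apply: cvg_norm; exact: cf.
  by apply: (cvgr_to_le cfx); exact: nearW.
split => //.
have [|||||_ _ h] := @dominated_convergence _ _ _ mu setT measurableT
  (fun n => EFin \o f_ n) (EFin \o f) (cst M%:E).
- by move=> n; exact/measurable_EFinP.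
- exact/measurable_EFinP.
- by apply: aeW => x _; apply: cvg_EFin; [exact: nearW|exact: cf].
- exact: finite_measure_integrable_cst.
- by apply: aeW => x n _; rewrite lee_fin.
by apply: fine_cvg; rewrite bmeas_EFin//; exact: h.
Qed.

End Integral.

Section Fubini.
Context d1 d2 (T1 : measurableType d1) (T2 : measurableType d2).
Context (m1 : probability T1 R) (m2 : probability T2 R).
Implicit Types f : T1 * T2 -> R.

Lemma bmeas_section1 f x : bounded_measurable f ->
  bounded_measurable (fun y => f (x, y)).
Proof. by apply: bmeas_comp; exact: measurable_pair1. Qed.

Lemma bmeas_section2 f y : bounded_measurable f ->
  bounded_measurable (fun x => f (x, y)).
Proof. by apply: bmeas_comp; exact: measurable_pair2. Qed.

Lemma bmeas_Rintegral f : bounded_measurable f ->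
  bounded_measurable (fun x => \int[m2]_y f (x, y)).
Proof.
move=> bf; have [mf [M fM]] := bf; split; last first.
  by exists M => x; apply: bmeas_norm_le => //; exact: bmeas_section1.
apply/measurable_EFinP.
rewrite (_ : _ \o _ = fubini_F m2 (EFin \o f)).
  by apply: (@measurable_fubini_F _ _ _ _ _ m1 m2); exact: bmeas_integrable.
by apply/funext => x /=; rewrite bmeas_EFin//; exact: bmeas_section1.
Qed.

Lemma bmeas_Rintegral2 f : bounded_measurable f ->
  bounded_measurable (fun y => \int[m1]_x f (x, y)).
Proof.
move=> bf; have [mf [M fM]] := bf; split; last first.
  by exists M => y; apply: bmeas_norm_le => //; exact: bmeas_section2.
apply/measurable_EFinP.
rewrite (_ : _ \o _ = fubini_G m1 (EFin \o f)).
  by apply: (@measurable_fubini_G _ _ _ _ _ m1 m2); exact: bmeas_integrable.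
by apply/funext => y /=; rewrite bmeas_EFin//; exact: bmeas_section2.
Qed.

Lemma bmeas_fubini1 f : bounded_measurable f ->
  \int[(m1 \x m2)%E]_p f p = \int[m1]_x \int[m2]_y f (x, y).
Proof.
move=> bf; apply: EFin_inj; rewrite !bmeas_EFin//; last exact: bmeas_Rintegral.
rewrite -(@integral12_prod_meas1 _ _ _ _ _ m1 m2)//; last exact: bmeas_integrable.
by apply: eq_integral => x _; rewrite bmeas_EFin//; exact: bmeas_section1.
Qed.

Lemma bmeas_fubini2 f : bounded_measurable f ->
  \int[(m1 \x m2)%E]_p f p = \int[m2]_y \int[m1]_x f (x, y).
Proof.
move=> bf; apply: EFin_inj; rewrite !bmeas_EFin//; last exact: bmeas_Rintegral2.
rewrite -(@integral21_prod_meas1 _ _ _ _ _ m1 m2)//; last exact: bmeas_integrable.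
by apply: eq_integral => y _; rewrite bmeas_EFin//; exact: bmeas_section2.
Qed.

End Fubini.
End BoundedMeasurable.

(** * Integration over sampled points *)

Section SampleMean.
Context {R : realType} d (J : measurableType d).
Implicit Types (f g : seq J -> R) (x s : seq J).

(** Functions of finitely many points live on lists, so that points are appended without casts
    between tuple types; [n] is the length at which measurability is tested. *)
Definition lmeas n f := bounded_measurable (fun t : n.-tuple J => f t).

Lemma measurable_nth n i :
  measurable_fun setT (fun t : n.-tuple J => nth point t i).
Proof.
have [ni|lt_in] := leqP n i.
  rewrite (_ : (fun _ => _) = cst point)//; apply/funext => t.
  by rewrite nth_default// size_tuple.
rewrite (_ : (fun _ => _) = @tnth _ J ^~ (Ordinal lt_in)).
  exact: measurable_tnth.
by apply/funext => t; rewrite (tnth_nth point).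
Qed.

(** A list-valued map of constant length is measurable as soon as its entries are; beyond the
    length, the entries are the constant [point]. *)
Lemma lmeas_comp d' (T : measurableType d') n (h : T -> seq J) f :
  (forall p, size (h p) = n) ->
  (forall i, measurable_fun setT (fun p => nth point (h p) i)) ->
  lmeas n f -> bounded_measurable (fun p => f (h p)).
Proof.
move=> sh mh bf.
pose h' p : n.-tuple J := Tuple (introT eqP (sh p)).
rewrite (_ : (fun p => _) = (fun p => f (h' p)))//.
apply: (@bmeas_comp _ _ _ _ _ h') bf.
apply/measurable_fun_tnthP => i.
rewrite (_ : _ \o _ = fun p => nth point (h p) i)//.
by apply/funext => p /=; rewrite (tnth_nth point).
Qed.

Lemma measurable_nth_cat d' (T : measurableType d') n (h1 h2 : T -> seq J) i :
  (forall p, size (h1 p) = n) ->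
  (forall i, measurable_fun setT (fun p => nth point (h1 p) i)) ->
  (forall i, measurable_fun setT (fun p => nth point (h2 p) i)) ->
  measurable_fun setT (fun p => nth point (h1 p ++ h2 p) i).
Proof.
move=> s1 m1 m2; rewrite (_ : (fun p => _) =
  fun p => if (i < n)%N then nth point (h1 p) i else nth point (h2 p) (i - n)).
  by case: (i < n)%N.
by apply/funext => p; rewrite nth_cat s1.
Qed.

Lemma measurable_nth_seq1 d' (T : measurableType d') (h : T -> J) i :
  measurable_fun setT h -> measurable_fun setT (fun p : T => nth point [:: h p] i).
Proof. by case: i => [//|i] mh /=; rewrite nth_nil; exact: measurable_cst. Qed.

Lemma lmeas_catl n m x f : size x = n -> lmeas (n + m) f ->
  lmeas m (fun s => f (x ++ s)).
Proof.
move=> sx; apply: lmeas_comp => [t|i]; first by rewrite size_cat sx size_tuple.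
apply: (@measurable_nth_cat _ _ n) => // j; last exact: measurable_nth.
Qed.

Lemma lmeas_cons m y f : lmeas m.+1 f -> lmeas m (fun s => f (y :: s)).
Proof. exact: (@lmeas_catl 1 m [:: y]). Qed.

Lemma lmeas_rcons n x f : size x = n -> lmeas n.+1 f ->
  bounded_measurable (fun y => f (rcons x y)).
Proof.
move=> sx; apply: lmeas_comp => [y|i]; first by rewrite size_rcons sx.
under eq_fun do rewrite -cats1.
apply: (@measurable_nth_cat _ _ n) => // j.
exact: measurable_nth_seq1.
Qed.

Lemma lmeas_cat n m f : lmeas (n + m) f ->
  bounded_measurable (fun p : n.-tuple J * m.-tuple J => f (p.1 ++ p.2)).
Proof.
apply: lmeas_comp => [p|i]; first by rewrite size_cat !size_tuple.
apply: (@measurable_nth_cat _ _ n) => [p|j|j]; first by rewrite size_tuple.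
- exact: (measurableT_comp (measurable_nth _)).
- exact: (measurableT_comp (measurable_nth _)).
Qed.

Lemma lmeas_tuple_rcons n f : lmeas n.+1 f ->
  bounded_measurable (fun p : n.-tuple J * J => f (rcons p.1 p.2)).
Proof.
apply: lmeas_comp => [p|i]; first by rewrite size_rcons size_tuple.
under eq_fun do rewrite -cats1.
apply: (@measurable_nth_cat _ _ n) => [p|j|j]; first by rewrite size_tuple.
- exact: (measurableT_comp (measurable_nth _)).
- exact: measurable_nth_seq1.
Qed.

Lemma lmeas_rcons2 n x f : size x = n -> lmeas n.+2 f ->
  bounded_measurable (fun p : J * J => f (rcons (rcons x p.1) p.2)).
Proof.
move=> sx; apply: lmeas_comp => [p|i]; first by rewrite !size_rcons sx.
under eq_fun do rewrite -!cats1.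
apply: (@measurable_nth_cat _ _ n.+1) => [p|j|j].
- by rewrite size_cat sx addn1.
- apply: (@measurable_nth_cat _ _ n) => // k.
  exact: measurable_nth_seq1.
- exact: measurable_nth_seq1.
Qed.

Lemma lmeas_take m1 m2 f : lmeas m1 f ->
  lmeas (m1 + m2) (fun s => f (take m1 s)).
Proof.
apply: lmeas_comp => [t|i].
  by rewrite size_takel// size_tuple leq_addr.
have [m1i|im1] := leqP m1 i.
  rewrite (_ : (fun _ => _) = cst point)//; apply/funext => t.
  by rewrite nth_default// (leq_trans _ m1i)// size_take_min geq_minl.
by under eq_fun do rewrite nth_take//; exact: measurable_nth.
Qed.

Lemma lmeas_drop m1 m2 f : lmeas m2 f ->
  lmeas (m1 + m2) (fun s => f (drop m1 s)).
Proof.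
apply: lmeas_comp => [t|i]; first by rewrite size_drop size_tuple addKn.
by under eq_fun do rewrite nth_drop; exact: measurable_nth.
Qed.

Context (mu : probability J R).

Definition sampleE m f : R := \int[power_prob mu m]_t f t.

Lemma eq_sampleE m f g : (forall s, size s = m -> f s = g s) ->
  sampleE m f = sampleE m g.
Proof. by move=> fg; apply: eq_Rintegral => t _; rewrite fg// size_tuple. Qed.

Lemma sampleE0 f : sampleE 0 f = f [::].
Proof.
rewrite /sampleE (@eq_Rintegral _ _ _ _ setT (fun=> f [::])) ?RintegralT_cst//.
by move=> t _; rewrite (tuple0 t).
Qed.

Lemma sampleES m f : lmeas m.+1 f ->
  sampleE m.+1 f = \int[mu]_y sampleE m (fun s => f (y :: s)).
Proof.
move=> bf.
have bf' : bounded_measurable (fun p : J * m.-tuple J => f (tcons p)).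
  by apply: bmeas_comp bf; exact: measurable_tcons.
rewrite -(@bmeas_fubini1 _ _ _ _ _ mu (power_prob mu m) (fun p => f (tcons p)))//.
rewrite /sampleE {1}/Rintegral /= integral_distribution//.
  by case: bf => mf _; exact/measurable_EFinP.
exact: (@bmeas_integrable _ _ _ (mu \x power_prob mu m)%E _ bf').
Qed.

Lemma lmeas_sampleE n m f : lmeas (n + m) f ->
  lmeas n (fun x => sampleE m (fun s => f (x ++ s))).
Proof. by move=> /lmeas_cat /(bmeas_Rintegral (power_prob mu n) (power_prob mu m)). Qed.

Lemma bmeas_sampleE_cons m f : lmeas m.+1 f ->
  bounded_measurable (fun y => sampleE m (fun s => f (y :: s))).
Proof.
move=> bf.
have bf' : bounded_measurable (fun p : J * m.-tuple J => f (tcons p)).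
  by apply: bmeas_comp bf; exact: measurable_tcons.
exact: (bmeas_Rintegral mu (power_prob mu m) bf').
Qed.

Lemma lmeas_Rintegral n f : lmeas n.+1 f ->
  lmeas n (fun x => \int[mu]_y f (rcons x y)).
Proof. by move=> /lmeas_tuple_rcons /(bmeas_Rintegral (power_prob mu n) mu). Qed.

(** Independence of the first [m1] sampled points from the [m2] others, by integrating out one point
    at a time. *)
Lemma sampleEM m1 m2 f g : lmeas m1 f -> lmeas m2 g ->
  sampleE (m1 + m2) (fun s => f (take m1 s) * g (drop m1 s)) =
  sampleE m1 f * sampleE m2 g.
Proof.
elim: m1 f => [|m1 IH] f bf bg.
  rewrite sampleE0 -bmeas_RintegralZl//; apply: eq_Rintegral => s _.
  by rewrite take0 drop0.
rewrite addSn sampleES; last first.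
  by rewrite -addSn; apply: bmeasM; [exact: lmeas_take|exact: lmeas_drop].
rewrite sampleES// -bmeas_RintegralZr; last exact: bmeas_sampleE_cons.
by apply: eq_Rintegral => y _; rewrite -(IH (fun s => f (y :: s)))//; exact: lmeas_cons.
Qed.

Lemma sampleE_nth m b (h : J -> R) : bounded_measurable h -> (b < m)%N ->
  sampleE m (fun s => h (nth point s b)) = \int[mu]_y h y.
Proof.
move=> bh; elim: m b => // m IH b bm.
rewrite sampleES; last by apply: bmeas_comp bh; exact: measurable_nth.
case: b bm => [_|b bm] /=; last by rewrite IH// RintegralT_cst.
by apply: eq_Rintegral => y _; rewrite /sampleE RintegralT_cst.
Qed.

(** Distinct sampled points are independent, each of law [mu]. Peeling off the head of the sample
    reaches whichever index is smaller, so both orders of integration occur. *)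
Lemma sampleE_nth2 m b c (g : J * J -> R) : bounded_measurable g ->
  (b < m)%N -> (c < m)%N -> b != c ->
  sampleE m (fun s => g (nth point s b, nth point s c)) =
  \int[(mu \x mu)%E]_p g p.
Proof.
move=> bg; elim: m b c => // m IH b c bm cm bc.
rewrite sampleES; last first.
  by apply: bmeas_comp bg; apply: measurable_fun_pair; exact: measurable_nth.
case: b c bm cm bc => [|b] [|c]//= bm cm bc.
- rewrite bmeas_fubini1//; apply: eq_Rintegral => y _.
  by rewrite -(@sampleE_nth m c)//; exact: bmeas_section1.
- rewrite bmeas_fubini2//; apply: eq_Rintegral => y _.
  by rewrite -(@sampleE_nth m b (fun z => g (z, y)))//; exact: bmeas_section2.
- by rewrite IH// RintegralT_cst.
Qed.

End SampleMean.

(** * Polynomials in the entries of a kernel *)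

Section Monomials.
Context {R : realType} d (J : measurableType d) (K : ternary_kernel J R).
Local Notation mu := (kmu K).
Implicit Types (x s : seq J) (t : nat * nat * nat) (L : seq (nat * nat * nat)).

Definition entry x t : R := K (nth point x t.1.1, nth point x t.1.2, nth point x t.2).

Definition monomial L x : R := \prod_(t <- L) entry x t.

Definition meval m L x : R := sampleE mu m (fun s => monomial L (x ++ s)).

(** A polynomial is pure syntax, hence can be evaluated in both kernels: a list of coefficients,
    each with a number of integrated points and the index triples of the factors. *)
Definition peval (p : seq (R * (nat * seq (nat * nat * nat)))) x : R :=
  \sum_(q <- p) q.1 * meval q.2.1 q.2.2 x.

Lemma kernel_bound : exists M : R, forall p, `|K p| <= M.
Proof.
have [M [_ hM]] := kfun_bounded K.
by exists (M + 1) => p; apply: hM => //; rewrite ltrDl.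
Qed.

Lemma lmeas_entry n t : lmeas n (fun x => entry x t).
Proof.
have [M KM] := kernel_bound.
split; last by exists M => x; exact: KM.
apply: (measurableT_comp (kfun_measurable K)).
apply: measurable_fun_pair; last exact: measurable_nth.
by apply: measurable_fun_pair; exact: measurable_nth.
Qed.

Lemma monomial_bound L : exists2 B : R, 0 <= B & forall x, `|monomial L x| <= B.
Proof.
have [M KM] := kernel_bound.
have M0 : 0 <= M by rewrite (le_trans _ (KM point)).
elim: L => [|t L [B B0 LB]].
  by exists 1 => // x; rewrite /monomial big_nil normr1.
exists (M * B) => [|x]; first exact: mulr_ge0.
by rewrite /monomial big_cons normrM ler_pM// ?LB// KM.
Qed.

Lemma lmeas_monomial n L : lmeas n (monomial L).
Proof. by apply: bmeas_prod => t; exact: lmeas_entry. Qed.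

Lemma lmeas_meval n m L : lmeas n (meval m L).
Proof. exact/lmeas_sampleE/lmeas_monomial. Qed.

Lemma lmeas_peval n p : lmeas n (peval p).
Proof.
elim: p => [|q p IH].
  rewrite (_ : peval [::] = cst 0); first exact: bmeas_cst.
  by apply/funext => x; rewrite /peval big_nil.
rewrite (_ : peval _ = fun x => q.1 * meval q.2.1 q.2.2 x + peval p x).
  apply: bmeasD IH; apply: bmeasM; first exact: bmeas_cst.
  exact: lmeas_meval.
by apply/funext => x; rewrite /peval big_cons.
Qed.

(* A monomial evaluated at a list of size n, to which m sampled points are
   appended.  Variables below k may only occur in first position, which makes
   the evaluation continuous in them for ndist. *)
Definition wf_monomial k n m L := all (fun t => [&& (t.1.1 < n + m)%N,
  (k <= t.1.2 < n + m)%N, (k <= t.2 < n + m)%N & t.1.2 != t.2]) L.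

Definition wf_poly k n (p : seq (R * (nat * seq (nat * nat * nat)))) :=
  all (fun q => wf_monomial k n q.2.1 q.2.2) p.

Lemma meval_Rintegral n m L x : size x = n ->
  \int[mu]_y meval m L (rcons x y) = meval m.+1 L x.
Proof.
move=> sx; rewrite /meval sampleES.
  by apply: eq_Rintegral => y _; apply: eq_sampleE => s _; rewrite cat_rcons.
by apply: (lmeas_catl sx); exact: lmeas_monomial.
Qed.

(** Renaming of indices that keeps the [n] free variables and moves the integrated ones past [m]
    others. *)
Definition shift n m i := if (i < n)%N then i else (i + m)%N.

Definition shift_monomial n m L : seq (nat * nat * nat) :=
  [seq (shift n m t.1.1, shift n m t.1.2, shift n m t.2) | t <- L].

Lemma wf_shift_monomial k n m1 m2 L : wf_monomial k n m2 L ->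
  wf_monomial k n (m1 + m2) (shift_monomial n m1 L).
Proof.
move=> /allP wf; apply/allP => _ /mapP[t /wf /and4P[t1 t2 t3 t4] ->] /=.
by rewrite /shift; apply/and4P; split; repeat case: ifPn; lia.
Qed.

Lemma wf_monomialW k n m1 m2 L : wf_monomial k n m1 L ->
  wf_monomial k n (m1 + m2) L.
Proof.
by move=> /allP wf; apply/allP => t /wf /and4P[? ? ? ?]; apply/and4P; split; lia.
Qed.

(** By independence, a product of integrals over separate blocks of sampled points is a single
    integral; the second factor is renamed to read the second block. *)
Lemma meval_mul k n m1 m2 L1 L2 x : size x = n ->
  wf_monomial k n m1 L1 -> wf_monomial k n m2 L2 ->
  meval m1 L1 x * meval m2 L2 x = meval (m1 + m2) (L1 ++ shift_monomial n m1 L2) x.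
Proof.
move=> sx wf1 wf2; rewrite -sampleEM.
- apply: eq_sampleE => s ss; rewrite /monomial big_cat big_map.
  have nth1 i : (i < n + m1)%N ->
      nth point (x ++ take m1 s) i = nth point (x ++ s) i.
    move=> im; rewrite !nth_cat sx; case: ltnP => // ni.
    by rewrite nth_take// ltn_subLR.
  have nth2 i : nth point (x ++ drop m1 s) i = nth point (x ++ s) (shift n m1 i).
    rewrite !nth_cat sx /shift; case: (ltnP i n) => [->//|ni].
    by rewrite ltnNge (leq_trans ni (leq_addr _ _))/= nth_drop addnC addnBAC.
  congr (_ * _); apply: eq_big_seq => t tL; rewrite /entry ?nth2//.
  by have /and4P[? /andP[_ ?] /andP[_ ?] _] := allP wf1 _ tL; rewrite !nth1.
- by apply: (lmeas_catl sx); exact: lmeas_monomial.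
- by apply: (lmeas_catl sx); exact: lmeas_monomial.
Qed.

Lemma bmeas_section_dist (a b : J) :
  bounded_measurable (fun p : J * J => `|K (a, p.1, p.2) - K (b, p.1, p.2)|).
Proof.
have [M KM] := kernel_bound.
apply: bmeas_abs; apply: bmeasB; (split; last by exists M => p; exact: KM);
  apply: (measurableT_comp (kfun_measurable K)); apply: measurable_fun_pair => //;
  exact: measurable_fun_pair.
Qed.

(** The variable [y] has index [n], so it occurs in first position only, and the two other positions
    hold distinct sampled points. Hence one entry changes in mean by at most [ndist K y y'];
    induction on the factors extends this to products. *)
Lemma monomial_lipschitz n m L x : size x = n -> wf_monomial n.+1 n.+1 m L ->
  exists C : R, forall y y', sampleE mu m
    (fun s => `|monomial L (rcons x y ++ s) - monomial L (rcons x y' ++ s)|)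
    <= C * ndist K y y'.
Proof.
move=> sx; have [M KM] := kernel_bound.
have M0 : 0 <= M by rewrite (le_trans _ (KM point)).
have bmon L' z : lmeas m (fun s => monomial L' (rcons x z ++ s)).
  by apply: (@lmeas_catl _ _ _ n.+1); [rewrite size_rcons sx|exact: lmeas_monomial].
have bent t z : lmeas m (fun s => entry (rcons x z ++ s) t).
  apply: (@lmeas_catl _ _ _ n.+1 _ _ (fun x => entry x t)); last exact: lmeas_entry.
  by rewrite size_rcons sx.
elim: L => [_|t L IH /= /andP[wt /IH[C hC]]].
  exists 0 => z z'; rewrite mul0r /monomial.
  by under eq_sampleE do rewrite !big_nil subrr normr0; rewrite /sampleE RintegralT_cst.
have [B B0 LB] := monomial_bound L.
exists (B + M * C) => z z'.
have h1 : sampleE mu m (fun s => `|entry (rcons x z ++ s) t - entry (rcons x z' ++ s) t|)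
    <= ndist K z z'.
  case/and4P: wt => t1 /andP[t2 t2'] /andP[t3 t3'] t23.
  have nthr u s i : (n.+1 <= i)%N -> nth point (rcons x u ++ s) i = nth point s (i - n.+1).
    by move=> ni; rewrite nth_cat size_rcons sx ltnNge ni.
  (* An entry whose first index is not [n] does not depend on [z]. *)
  have [tn|tn] := eqVneq t.1.1 n; last first.
    rewrite (@eq_sampleE _ _ _ _ _ _ (fun=> 0)).
      by rewrite /sampleE RintegralT_cst Rintegral_ge0.
    move=> s ss; rewrite /entry !(nthr _ _ t.1.2)// !(nthr _ _ t.2)//.
    rewrite (_ : nth point (rcons x z ++ s) t.1.1 = nth point (rcons x z' ++ s) t.1.1).
      by rewrite subrr normr0.
    rewrite !nth_cat !size_rcons sx ltnS; case: leqP => // tn'.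
    by rewrite !nth_rcons sx ltn_neqAle tn tn'.
  rewrite /ndist -(@sampleE_nth2 _ _ _ mu m (t.1.2 - n.+1) (t.2 - n.+1)
    (fun p => `|K (z, p.1, p.2) - K (z', p.1, p.2)|))//; last 4 first.
  - exact: bmeas_section_dist.
  - by rewrite ltn_subLR.
  - by rewrite ltn_subLR.
  - by rewrite eqn_sub2rE.
  have nthn u s : nth point (rcons x u ++ s) t.1.1 = u.
    by rewrite nth_cat size_rcons sx tn ltnSn nth_rcons sx ltnn eqxx.
  by under eq_sampleE do rewrite /entry !(nthr _ _ t.1.2)// !(nthr _ _ t.2)// !nthn.
apply: (@le_trans _ _ (sampleE mu m (fun s =>
  B * `|entry (rcons x z ++ s) t - entry (rcons x z' ++ s) t| +
  M * `|monomial L (rcons x z ++ s) - monomial L (rcons x z' ++ s)|))).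
  apply: bmeas_le.
  - by apply: bmeas_abs; apply: bmeasB; exact: bmon.
  - by apply: bmeasD; apply: bmeasM; try exact: bmeas_cst;
      apply: bmeas_abs; apply: bmeasB; (exact: bmon || exact: bent).
  move=> s; rewrite /monomial !big_cons -/(monomial _ _).
  rewrite -!/(monomial _ _).
  set e := entry _ t; set e' := entry _ t; set q := monomial _ _; set q' := monomial _ _.
  (* Each increment is multiplied by a factor with a known bound. *)
  have -> : e * q - e' * q' = (e - e') * q + e' * (q - q') by ring.
  rewrite (le_trans (ler_normD _ _))// !normrM [X in X + _]mulrC.
  by apply: lerD; apply: ler_wpM2r => //; [exact: LB|exact: KM].
rewrite /sampleE bmeas_RintegralD; last 2 first.
- by apply: bmeasM; [exact: bmeas_cst|apply: bmeas_abs; apply: bmeasB; exact: bent].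
- by apply: bmeasM; [exact: bmeas_cst|apply: bmeas_abs; apply: bmeasB; exact: bmon].
rewrite !bmeas_RintegralZl.
- by rewrite mulrDl -mulrA; apply: lerD; apply: ler_wpM2l => //; exact: hC.
- by apply: bmeas_abs; apply: bmeasB; exact: bmon.
- by apply: bmeas_abs; apply: bmeasB; exact: bent.
Qed.

Lemma ndist_ge0 y y' : 0 <= ndist K y y'.
Proof. exact: Rintegral_ge0. Qed.

Lemma peval_lipschitz n p x : size x = n -> wf_poly n.+1 n.+1 p ->
  exists2 C : R, 0 <= C & forall y y',
    `|peval p (rcons x y) - peval p (rcons x y')| <= C * ndist K y y'.
Proof.
move=> sx; elim: p => [_|q p IH /= /andP[wq /IH[C C0 hC]]].
  by exists 0 => // y y'; rewrite /peval !big_nil subrr normr0 mul0r.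
have [C' hC'] := monomial_lipschitz sx wq.
(* [C'] comes without a sign, hence its absolute value. *)
exists (`|q.1| * `|C'| + C) => [|y y']; first by rewrite addr_ge0// mulr_ge0.
rewrite /peval !big_cons -!/(peval _ _) opprD addrACA.
rewrite (le_trans (ler_normD _ _))// mulrDl lerD//.
rewrite -mulrBr normrM -mulrA ler_wpM2l//.
have bmon z : lmeas q.2.1 (fun s => monomial q.2.2 (rcons x z ++ s)).
  by apply: (@lmeas_catl _ _ _ n.+1); [rewrite size_rcons sx|exact: lmeas_monomial].
rewrite /meval -bmeas_RintegralB; [|exact: bmon|exact: bmon].
rewrite (le_trans (le_normr_Rintegral _ (bmeas_integrable _ _)))//.
  by apply: bmeasB; exact: bmon.
by rewrite (le_trans (hC' _ _))// ler_wpM2r ?ler_norm// ndist_ge0.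
Qed.

End Monomials.

(** * Definable functions *)

Section SampledArray.
Context {R : realType} d (J : measurableType d) (K : ternary_kernel J R) (n : nat).

(** The generators of [array_measurable], named in order to make arrays a measurable space and the
    sampled array a random variable. *)
Definition coordinate_events : set (set (array R n)) :=
  \bigcup_(p in [set: 'I_n * 'I_n * 'I_n])
    preimage_set_system setT (fun H : array R n => H p) measurable.

Local Notation arrayT := (g_sigma_algebraType coordinate_events).

Definition sampled_array (S : n.-tuple J) : arrayT := sample_array K S.

Lemma measurable_sampled_array : measurable_fun setT sampled_array.
Proof.
apply: (@measurability _ _ _ arrayT _ _ coordinate_events) => // _ [B [p _ [C mC <-]] <-].
rewrite !setTI; have := sample_array_measurable K p.
by move=> /(_ measurableT C mC); rewrite setTI.
Qed.

HB.instance Definition _ :=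
  isMeasurableFun.Build _ _ _ _ sampled_array measurable_sampled_array.

Lemma measurable_array_coordinate p :
  measurable_fun setT (fun H : arrayT => H p).
Proof.
move=> _ C mC; rewrite setTI; apply: sub_sigma_algebra.
by exists p => //; exists C => //; rewrite setTI.
Qed.

Lemma Rintegral_sampled_array (phi : arrayT -> R) : bounded_measurable phi ->
  \int[power_prob (kmu K) n]_S phi (sample_array K S) =
  \int[distribution (power_prob (kmu K) n) sampled_array]_H phi H.
Proof.
move=> bphi; rewrite [RHS]/Rintegral integral_distribution//.
  by case: bphi => ? _; exact/measurable_EFinP.
apply: (@bmeas_integrable _ _ _ _ (fun S => phi (sampled_array S))).
exact: bmeas_comp measurable_sampled_array bphi.
Qed.

End SampledArray.

Section Definable.
Context {R : realType} d1 d2 (J1 : measurableType d1) (J2 : measurableType d2).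
Context (K1 : ternary_kernel J1 R) (K2 : ternary_kernel J2 R).
Implicit Types k n : nat.

Lemma Rintegral_same_sampling n (phi : g_sigma_algebraType (@coordinate_events R n) -> R) :
  same_sampling K1 K2 -> (0 < n)%N -> bounded_measurable phi ->
  \int[power_prob (kmu K1) n]_S phi (sample_array K1 S) =
  \int[power_prob (kmu K2) n]_S phi (sample_array K2 S).
Proof.
move=> same n0 bphi; rewrite !Rintegral_sampled_array//; congr fine.
by apply: eq_measure_integral => A mA _; exact: same.
Qed.

(** A monomial without free variable is a function of the sampled array, so its mean depends on the
    law of that array only. *)
Lemma meval_same_sampling m L : same_sampling K1 K2 -> wf_monomial 0 0 m L ->
  meval K1 m L [::] = meval K2 m L [::].
Proof.
(* [same_sampling] concerns positive sizes; without sampled points, well-formedness leaves only the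
   empty product. *)
move=> same; case: m => [|m] wf.
  case: L wf => [_|t L //].
  rewrite /meval /monomial.
  by under eq_sampleE do rewrite big_nil; under [RHS]eq_sampleE do rewrite big_nil;
    rewrite /sampleE !RintegralT_cst.
have [M1 K1M] := kernel_bound K1; have [M2 K2M] := kernel_bound K2.
pose M := Num.max M1 M2.
have M0 : 0 <= M by rewrite le_max (le_trans _ (K1M point)).
(* truncation makes the product bounded on all arrays without changing it on
   the sampled ones *)
pose clip (v : R) := Num.max (- M) (Num.min M v).
pose phi (H : array R m.+1) :=
  \prod_(t <- L) clip (H (inord t.1.1, inord t.1.2, inord t.2)).
have phiE d (J : measurableType d) (K : ternary_kernel J R) (S : m.+1.-tuple J) :
    (forall p, `|K p| <= M) -> monomial K L S = phi (sample_array K S).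
  move=> KM; apply: eq_big_seq => t tL; rewrite /sample_array /= !(tnth_nth point).
  have /and4P[t1 /andP[_ t2] /andP[_ t3] _] := allP wf _ tL.
  (* By well-formedness [inord] never takes its default value, and the bound [M] makes the
     truncation inactive. *)
  rewrite !inordK// /clip /entry; set v := K _.
  have /ler_normlP[Mv vM] : `|v| <= M by exact: KM.
  by rewrite min_r// max_r// lerNl.
have mphi : @bounded_measurable R _ (g_sigma_algebraType (@coordinate_events R m.+1)) phi.
  apply: bmeas_prod => t; split.
    apply: measurable_maxr => //; apply: measurable_minr => //.
    exact: measurable_array_coordinate.
  exists M => H; rewrite ler_norml /clip le_max lexx/= ge_max ge_min lexx/= andbT.
  by rewrite (le_trans _ M0)// oppr_le0.
rewrite /meval; transitivity (\int[power_prob (kmu K1) m.+1]_S phi (sample_array K1 S)).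
  apply: eq_Rintegral => S _; apply: phiE => p.
  by rewrite (le_trans (K1M p))// le_max lexx.
rewrite Rintegral_same_sampling//; apply: eq_Rintegral => S _; apply/esym/phiE => p.
by rewrite (le_trans (K2M p))// le_max lexx orbT.
Qed.

Lemma peval_same_sampling p : same_sampling K1 K2 -> wf_poly 0 0 p ->
  peval K1 p [::] = peval K2 p [::].
Proof.
move=> same /allP wf; apply: eq_big_seq => q qp.
by rewrite (meval_same_sampling same (wf _ qp)).
Qed.

(* Uniform limits, on lists of n points, of one and the same polynomial
   evaluated in both kernels. *)
Definition definable k n (f1 : seq J1 -> R) (f2 : seq J2 -> R) := [/\ lmeas n f1, lmeas n f2 &
  forall e, 0 < e -> exists p, [/\ wf_poly k n p,
    forall x, size x = n -> `|f1 x - peval K1 p x| <= e &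
    forall x, size x = n -> `|f2 x - peval K2 p x| <= e]].

Lemma definable_peval k n p : wf_poly k n p -> definable k n (peval K1 p) (peval K2 p).
Proof.
move=> wf; split; [exact: lmeas_peval|exact: lmeas_peval|move=> e e0].
by exists p; split => // x _; rewrite subrr normr0 ltW.
Qed.

Lemma eq_definable k n f1 f2 g1 g2 :
  (forall x, size x = n -> f1 x = g1 x) -> (forall x, size x = n -> f2 x = g2 x) ->
  definable k n f1 f2 -> definable k n g1 g2.
Proof.
move=> fg1 fg2 [m1 m2 h]; split.
- rewrite /lmeas (_ : (fun t : n.-tuple J1 => _) = fun t : n.-tuple J1 => f1 t)//.
  by apply/funext => t; rewrite fg1// size_tuple.
- rewrite /lmeas (_ : (fun t : n.-tuple J2 => _) = fun t : n.-tuple J2 => f2 t)//.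
  by apply/funext => t; rewrite fg2// size_tuple.
- move=> e /h[p [wf h1 h2]]; exists p; split => // x sx.
    by rewrite -fg1// h1.
  by rewrite -fg2// h2.
Qed.

Lemma definable_lim k n f1 f2 : lmeas n f1 -> lmeas n f2 ->
  (forall e, 0 < e -> exists g1 g2, [/\ definable k n g1 g2,
    forall x, size x = n -> `|f1 x - g1 x| <= e &
    forall x, size x = n -> `|f2 x - g2 x| <= e]) -> definable k n f1 f2.
Proof.
move=> m1 m2 h; split => // e e0; have e20 : 0 < e / 2 by rewrite divr_gt0.
have [g1 [g2 [[_ _ /(_ _ e20)[p [wf p1 p2]]] h1 h2]]] := h _ e20.
exists p; split => // x sx; rewrite [e in leRHS]splitr.
  by rewrite (le_trans (ler_distD (g1 x) _ _))// lerD// ?h1// p1.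
by rewrite (le_trans (ler_distD (g2 x) _ _))// lerD// ?h2// p2.
Qed.

Lemma definable_cst k n (c : R) : definable k n (fun=> c) (fun=> c).
Proof.
have h d (J : measurableType d) (K : ternary_kernel J R) x :
    peval K [:: (c, (0, [::]))] x = c.
  rewrite /peval big_seq1 /meval sampleE0 /monomial big_nil mulr1.
  by [].
apply: (@eq_definable k n (peval K1 [:: (c, (0, [::]))]) (peval K2 [:: (c, (0, [::]))])).
- by move=> x _; exact: h.
- by move=> x _; exact: h.
- exact: definable_peval.
Qed.

Lemma definable_entry k n (a b c : nat) : (a < n)%N -> (k <= b < n)%N ->
  (k <= c < n)%N -> b != c ->
  definable k n (fun x => entry K1 x (a, b, c)) (fun x => entry K2 x (a, b, c)).
Proof.
move=> an bn cn bc; pose p : seq (R * (nat * seq (nat * nat * nat))) :=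
  [:: (1, (0, [:: (a, b, c)]))].
have h d (J : measurableType d) (K : ternary_kernel J R) x :
    peval K p x = entry K x (a, b, c).
  by rewrite /peval big_seq1 /meval sampleE0 /monomial big_seq1 cats0 mul1r.
apply: (@eq_definable k n (peval K1 p) (peval K2 p)).
- by move=> x _; exact: h.
- by move=> x _; exact: h.
- by apply: definable_peval; rewrite /p/= /wf_monomial/= addn0 an bn cn bc.
Qed.

Lemma definableD k n f1 f2 g1 g2 : definable k n f1 f2 -> definable k n g1 g2 ->
  definable k n (fun x => f1 x + g1 x) (fun x => f2 x + g2 x).
Proof.
move=> [mf1 mf2 hf] [mg1 mg2 hg]; split; [exact: bmeasD|exact: bmeasD|].
move=> e e0; have e20 : 0 < e / 2 by rewrite divr_gt0.
have [p [wp p1 p2]] := hf _ e20; have [q [wq q1 q2]] := hg _ e20.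
exists (p ++ q); split; first by rewrite /wf_poly all_cat; apply/andP.
- move=> x sx; rewrite /peval big_cat opprD addrACA (le_trans (ler_normD _ _))//.
  by rewrite [e in leRHS]splitr lerD// ?p1// q1.
- move=> x sx; rewrite /peval big_cat opprD addrACA (le_trans (ler_normD _ _))//.
  by rewrite [e in leRHS]splitr lerD// ?p2// q2.
Qed.

Definition mul_poly n (p q : seq (R * (nat * seq (nat * nat * nat)))) :=
  [seq (u.1 * v.1, ((u.2.1 + v.2.1)%N, u.2.2 ++ shift_monomial n u.2.1 v.2.2))
    | u <- p, v <- q].

Lemma peval_mul d (J : measurableType d) (K : ternary_kernel J R) k n p q x :
  size x = n -> wf_poly k n p -> wf_poly k n q ->
  peval K (mul_poly n p q) x = peval K p x * peval K q x.
Proof.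
move=> sx /allP wp /allP wq; rewrite /peval big_allpairs_dep mulr_suml.
apply: eq_big_seq => u up; rewrite mulr_sumr; apply: eq_big_seq => v vq /=.
by rewrite mulrACA (meval_mul K sx (wp _ up) (wq _ vq)).
Qed.

Lemma wf_mul_poly k n (p q : seq (R * (nat * seq (nat * nat * nat)))) :
  wf_poly k n p -> wf_poly k n q -> wf_poly k n (mul_poly n p q).
Proof.
move=> /allP wp /allP wq; apply/allP => _ /allpairsP[[u v] /= [up vq ->]] /=.
rewrite /wf_monomial all_cat; apply/andP; split.
  exact: wf_monomialW (wp _ up).
exact: wf_shift_monomial (wq _ vq).
Qed.

Lemma lmeas_bound d (J : measurableType d) n (f : seq J -> R) : lmeas n f ->
  exists M : R, forall x, size x = n -> `|f x| <= M.
Proof.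
by move=> [_ [M fM]]; exists M => x sx; apply: (fM (Tuple (introT eqP sx))).
Qed.

Lemma definableM k n f1 f2 g1 g2 : definable k n f1 f2 -> definable k n g1 g2 ->
  definable k n (fun x => f1 x * g1 x) (fun x => f2 x * g2 x).
Proof.
move=> [mf1 mf2 hf] [mg1 mg2 hg]; split; [exact: bmeasM|exact: bmeasM|].
have [M1 f1M] := lmeas_bound mf1; have [M2 f2M] := lmeas_bound mf2.
have [N1 g1N] := lmeas_bound mg1; have [N2 g2N] := lmeas_bound mg2.
pose B := `|M1| + `|M2| + `|N1| + `|N2| + 1.
have B0 : 0 < B by rewrite ltr_wpDl// !addr_ge0.
(* The expansion uses the bounds on [f] and [g], not on the polynomials [p] and [q]; its middle term
   is quadratic in the error and becomes linear through [e <= 1]. *)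
have close (f g p q e : R) : `|f| <= B -> `|g| <= B -> e <= 1 ->
    `|f - p| <= e -> `|g - q| <= e -> `|f * g - p * q| <= e * (B + B + 1).
  move=> fB gB e1 fp gq.
  have -> : f * g - p * q = (f - p) * g + (p - f) * (g - q) + f * (g - q) by ring.
  have h1 : `|(f - p) * g| <= e * B by rewrite normrM ler_pM.
  have h2 : `|(p - f) * (g - q)| <= e * 1.
    by rewrite normrM ler_pM// ?(le_trans gq)// distrC.
  have h3 : `|f * (g - q)| <= B * e by rewrite normrM ler_pM.
  have h4 := ler_normD ((f - p) * g + (p - f) * (g - q)) (f * (g - q)).
  have h5 := ler_normD ((f - p) * g) ((p - f) * (g - q)).
  rewrite (le_trans h4)//; lra.
move=> e e0; pose e' := Num.min 1 (e / (B + B + 1)).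
have BB0 : 0 < B + B + 1 by lra.
have e'0 : 0 < e' by rewrite lt_min ltr01 divr_gt0.
have e'e : e' * (B + B + 1) <= e by rewrite -ler_pdivlMr// ge_min lexx orbT.
have e'1 : e' <= 1 by rewrite ge_min lexx.
have [p [wp p1 p2]] := hf _ e'0; have [q [wq q1 q2]] := hg _ e'0.
have [B1 B2 B3 B4] : [/\ M1 <= B, M2 <= B, N1 <= B & N2 <= B].
  have := (ler_norm M1, ler_norm M2, ler_norm N1, ler_norm N2).
  have := (normr_ge0 M1, normr_ge0 M2, normr_ge0 N1, normr_ge0 N2).
  by move=> [[[? ?] ?] ?] [[[? ?] ?] ?]; rewrite /B; split; lra.
exists (mul_poly n p q); split; first exact: wf_mul_poly.
- move=> x sx; rewrite (peval_mul K1 sx wp wq) (le_trans _ e'e)//.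
  by apply: close; rewrite ?p1 ?q1// ?(le_trans (f1M _ sx))// (le_trans (g1N _ sx)).
- move=> x sx; rewrite (peval_mul K2 sx wp wq) (le_trans _ e'e)//.
  by apply: close; rewrite ?p2 ?q2// ?(le_trans (f2M _ sx))// (le_trans (g2N _ sx)).
Qed.

(** The last free variable becomes the first sampled point and keeps its index [n]. So the index
    triples stay as they are, and only the number of integrated points grows. *)
Lemma definable_Rintegral k n f1 f2 : definable k n.+1 f1 f2 ->
  definable k n (fun x => \int[kmu K1]_y f1 (rcons x y))
                (fun x => \int[kmu K2]_y f2 (rcons x y)).
Proof.
move=> [m1 m2 h]; split; [exact: lmeas_Rintegral|exact: lmeas_Rintegral|].
move=> e /h[p [/allP wp p1 p2]].
exists [seq (q.1, (q.2.1.+1, q.2.2)) | q <- p].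
have pE d (J : measurableType d) (K : ternary_kernel J R) x : size x = n ->
    peval K [seq (q.1, (q.2.1.+1, q.2.2)) | q <- p] x =
    \int[kmu K]_y peval K p (rcons x y).
  move=> sx; elim: {wp p1 p2} p => [|q p IH].
    by rewrite /peval big_nil; under eq_Rintegral do rewrite big_nil; rewrite RintegralT_cst.
  rewrite /peval big_cons -/(peval _ _ _) IH/=.
  under [RHS]eq_Rintegral do rewrite big_cons -/(peval _ _ _).
  have b1 : bounded_measurable (fun y => meval K q.2.1 q.2.2 (rcons x y)).
    by apply: (lmeas_rcons sx); exact: lmeas_meval.
  rewrite bmeas_RintegralD; last 2 first.
    by apply: bmeasM b1; exact: bmeas_cst.
    by apply: (lmeas_rcons sx); exact: lmeas_peval.
  by rewrite bmeas_RintegralZl// (meval_Rintegral K _ _ sx).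
split.
- apply/allP => _ /mapP[q qp ->] /=; move: (wp _ qp); rewrite /wf_monomial.
  by rewrite addSnnS.
- move=> x sx; rewrite pE//; apply: bmeas_dist_le.
  + exact: lmeas_rcons m1.
  + by apply: (lmeas_rcons sx); exact: lmeas_peval.
  + by move=> y; rewrite p1// size_rcons sx.
- move=> x sx; rewrite pE//; apply: bmeas_dist_le.
  + exact: lmeas_rcons m2.
  + by apply: (lmeas_rcons sx); exact: lmeas_peval.
  + by move=> y; rewrite p2// size_rcons sx.
Qed.

Lemma definable_leq k k' n f1 f2 : (k' <= k)%N -> definable k n f1 f2 ->
  definable k' n f1 f2.
Proof.
move=> kk' [m1 m2 h]; split => // e /h[p [/allP wp p1 p2]].
exists p; split => //; apply/allP => q /wp /allP wq; apply/allP => t /wq.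
by move=> /and4P[-> /andP[kt ->] /andP[kt' ->] ->]; rewrite !(leq_trans kk').
Qed.

Lemma definable_same_sampling f1 f2 : same_sampling K1 K2 -> definable 0 0 f1 f2 ->
  f1 [::] = f2 [::].
Proof.
move=> same [_ _ h]; apply/eqP; rewrite -subr_eq0 -normr_le0.
apply/ler_addgt0Pr => e e0; rewrite add0r; have e20 : 0 < e / 2 by rewrite divr_gt0.
have [p [wp /(_ [::] erefl) p1 /(_ [::] erefl) p2]] := h _ e20.
rewrite (le_trans (ler_distD (peval K1 p [::]) _ _))// [e in leRHS]splitr lerD//.
by rewrite distrC peval_same_sampling.
Qed.

End Definable.

(** * Open sets and balls of the neighborhood pseudo-distance *)

Section NeighborhoodTopology.
Context {R : realType} d (J : measurableType d) (K : ternary_kernel J R).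

Lemma nspace_ballE (x y : nspace K) (e : R) : ball x e y = (ndist K x y < e).
Proof. by []. Qed.

Lemma open_nspaceP (U : set J) : open (U : set (nspace K)) <->
  (forall x, U x -> exists2 e : R, 0 < e & forall y, ndist K x y < e -> U y).
Proof.
rewrite openE; split=> [oU x /oU /nbhs_ballP[e e0 xU]|h x /h[e e0 xU]].
  by exists e => // y xy; exact: xU.
by apply/nbhs_ballP; exists e => // y; exact: xU.
Qed.

Lemma open_ndist_ball (x : J) (r : R) : open ([set y | ndist K x y < r] : set (nspace K)).
Proof.
apply/open_nspaceP => y /= xy; exists (r - ndist K x y); first by rewrite subr_gt0.
by move=> z yz; rewrite (le_lt_trans (ndist_triangle _ y _ _))// -ltrBrDl.
Qed.

End NeighborhoodTopology.

(** * Uniform polynomial approximation of the absolute value on [-1, 1] *)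

Section AbsoluteValue.
Context {R : realType}.

(* Newton-like iteration [a + (v ^ 2 - a ^ 2) / 2] converging to |v| from below *)
Fixpoint abs_approx (k : nat) (v : R) : R :=
  if k is k'.+1 then
    let a := abs_approx k' v in a + (v * v - a * a) / 2
  else 0.

(** With u = |v| and a the current iterate, one step multiplies the error u - a by 1 - (u + a) / 2,
    which lies between 0 and 1 - u / 2 because 0 <= a <= u <= 1. *)
Lemma abs_approx_bound (k : nat) (v : R) : `|v| <= 1 ->
  0 <= abs_approx k v <= `|v| /\
  `|v| - abs_approx k v <= `|v| * (1 - `|v| / 2) ^+ k.
Proof.
have := normr_ge0 v; set u := `|v| => u0 u1.
have vv : v * v = u * u by rewrite /u -normrM ger0_norm// -expr2 sqr_ge0.
elim: k => [|k [/andP[a0 au] IH]] /=; first by rewrite lexx u0 subr0 expr0 mulr1.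
rewrite vv; set a := abs_approx k v in a0 au IH *.
have -> : u - (a + (u * u - a * a) / 2) = (u - a) * (1 - (u + a) / 2) by field.
split.
  apply/andP; split; first by nra.
  rewrite -subr_ge0.
  have -> : u - (a + (u * u - a * a) / 2) = (u - a) * (1 - (u + a) / 2) by field.
  by rewrite mulr_ge0//; lra.
rewrite exprSr mulrA; apply: (@le_trans _ _ ((u - a) * (1 - u / 2))).
  by rewrite ler_wpM2l//; lra.
by rewrite ler_wpM2r//; lra.
Qed.

(** The rate 1 - |v| / 2 is not uniform near 0, but there the error is at most |v|. For |v| > e the
    rate is at most 1 - e / 2. *)
Lemma abs_approx_unif (e : R) : 0 < e ->
  exists k, forall v, `|v| <= 1 -> `| `|v| - abs_approx k v| <= e.
Proof.
move=> e0; have [e1|e1] := leP 1 e.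
  by exists 0 => v v1; rewrite /= subr0 normr_id (le_trans v1).
have e2 : 0 <= 1 - e / 2 by lra.
have : (fun k => (1 - e / 2) ^+ k) @ \oo --> (0 : R).
  by apply: cvg_expr; rewrite ger0_norm//; lra.
move=> /cvgrPdist_le /(_ _ e0)[k _ /(_ _ (leqnn k))].
rewrite /= sub0r normrN ger0_norm ?exprn_ge0// => hk; exists k => v v1.
have [/andP[a0 au] h] := abs_approx_bound k v1.
have v0 := normr_ge0 v.
have v2 : 0 <= 1 - `|v| / 2 by lra.
rewrite ger0_norm ?subr_ge0// (le_trans h)//.
have [ve|ev] := leP `|v| e.
  by rewrite (le_trans _ ve)// ler_piMr// exprn_ile1//; lra.
apply: le_trans hk; apply: (@le_trans _ _ (1 * (1 - `|v| / 2) ^+ k)).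
  by rewrite ler_wpM2r// exprn_ge0.
by rewrite mul1r lerXn2r ?nnegrE//; lra.
Qed.

End AbsoluteValue.

(** * Definable functions: lattice operations, finite sums and products *)

Section Lattice.
Context {R : realType} d1 d2 (J1 : measurableType d1) (J2 : measurableType d2).
Context (K1 : ternary_kernel J1 R) (K2 : ternary_kernel J2 R).
Variables k n : nat.
Local Notation definable := (definable K1 K2 k n).

Lemma definableZ c f1 f2 : definable f1 f2 ->
  definable (fun x => c * f1 x) (fun x => c * f2 x).
Proof. by move=> df; apply: definableM => //; exact: definable_cst. Qed.

Lemma definableB f1 f2 g1 g2 : definable f1 f2 -> definable g1 g2 ->
  definable (fun x => f1 x - g1 x) (fun x => f2 x - g2 x).
Proof.
move=> df /(definableZ (-1)) dg.
by apply: eq_definable (definableD df dg) => x _; rewrite mulN1r.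
Qed.

Lemma definable_abs f1 f2 : definable f1 f2 ->
  definable (fun x => `|f1 x|) (fun x => `|f2 x|).
Proof.
move=> df; have [m1 m2 _] := df.
have [M1 f1M] := lmeas_bound m1; have [M2 f2M] := lmeas_bound m2.
(* A positive bound common to both functions; dividing by it brings the values into [-1, 1], where
   [abs_approx] converges uniformly. *)
pose M := `|M1| + `|M2| + 1.
have := (ler_norm M1, ler_norm M2); have := (normr_ge0 M1, normr_ge0 M2).
move=> [? ?] [? ?]; have M0 : 0 < M by rewrite /M; lra.
apply: definable_lim; [exact: bmeas_abs|exact: bmeas_abs|move=> e e0].
have [i hi] := abs_approx_unif (divr_gt0 e0 M0).
have dapprox j : definable (fun x => abs_approx j (M^-1 * f1 x))
                           (fun x => abs_approx j (M^-1 * f2 x)).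
  elim: j => [|j IH] /=; first exact: definable_cst.
  apply: definableD => //.
  apply: definableM; last exact: definable_cst.
  by apply: definableB; apply: definableM => //; exact: definableZ.
exists (fun x => M * abs_approx i (M^-1 * f1 x)), (fun x => M * abs_approx i (M^-1 * f2 x)).
have close (v : R) : `|v| <= M -> `| `|v| - M * abs_approx i (M^-1 * v)| <= e.
  move=> vM; have v1 : `|M^-1 * v| <= 1.
    by rewrite normrM gtr0_norm ?invr_gt0// ler_pdivrMl// mulr1.
  have -> : `|v| = M * `|M^-1 * v|.
    by rewrite normrM gtr0_norm ?invr_gt0// mulrA divff ?mul1r// gt_eqF.
  by rewrite -mulrBr normrM gtr0_norm// -ler_pdivlMl// [leRHS]mulrC hi.
split; first exact: definableZ.
- by move=> x sx; apply: close; rewrite (le_trans (f1M _ sx))// /M; lra.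
- by move=> x sx; apply: close; rewrite (le_trans (f2M _ sx))// /M; lra.
Qed.

Lemma definable_min f1 f2 g1 g2 : definable f1 f2 -> definable g1 g2 ->
  definable (fun x => Num.min (f1 x) (g1 x)) (fun x => Num.min (f2 x) (g2 x)).
Proof.
move=> df dg; apply: eq_definable
  (definableZ 2^-1 (definableB (definableD df dg) (definable_abs (definableB df dg))))
  => x _; by rewrite minr_absE mulrC.
Qed.

Lemma definable_max f1 f2 g1 g2 : definable f1 f2 -> definable g1 g2 ->
  definable (fun x => Num.max (f1 x) (g1 x)) (fun x => Num.max (f2 x) (g2 x)).
Proof.
move=> df dg; apply: eq_definable
  (definableZ 2^-1 (definableD (definableD df dg) (definable_abs (definableB df dg))))
  => x _; by rewrite maxr_absE mulrC.
Qed.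

Lemma definable_sum (A : Type) (s : seq A) f1 f2 :
  (forall a, definable (f1 a) (f2 a)) ->
  definable (fun x => \sum_(a <- s) f1 a x) (fun x => \sum_(a <- s) f2 a x).
Proof.
move=> df; elim: s => [|a s IH].
  by apply: eq_definable (definable_cst _ _ _ _ 0) => x _; rewrite big_nil.
by apply: eq_definable (definableD (df a) IH) => x _; rewrite big_cons.
Qed.

Lemma definable_prod (A : eqType) (s : seq A) f1 f2 :
  (forall a, a \in s -> definable (f1 a) (f2 a)) ->
  definable (fun x => \prod_(a <- s) f1 a x) (fun x => \prod_(a <- s) f2 a x).
Proof.
elim: s => [_|a s IH df].
  by apply: eq_definable (definable_cst _ _ _ _ 1) => x _; rewrite big_nil.
have dfa := definableM (df a (mem_head _ _))
  (IH (fun b bs => df b (mem_behead (s := a :: s) bs))).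
by apply: eq_definable dfa => x _; rewrite big_cons.
Qed.

End Lattice.

(** * Continuity of definable functions, and matched lists *)

Section Matching.
Context {R : realType} d1 d2 (J1 : measurableType d1) (J2 : measurableType d2).
Context (K1 : ternary_kernel J1 R) (K2 : ternary_kernel J2 R).

Lemma definable_sym k n f1 f2 : definable K1 K2 k n f1 f2 -> definable K2 K1 k n f2 f1.
Proof. by move=> [m1 m2 h]; split => // e /h[p [wf h1 h2]]; exists p. Qed.

(** A uniform limit of polynomials that are Lipschitz in the last variable. The radius is divided by
    [C + 1] since [C] may vanish. *)
Lemma definable_continuous n f1 f2 x (y : J1) e :
  definable K1 K2 n.+1 n.+1 f1 f2 -> size x = n -> 0 < e ->
  exists2 r : R, 0 < r & forall z, ndist K1 y z < r ->
    `|f1 (rcons x y) - f1 (rcons x z)| < e.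
Proof.
move=> [_ _ h] sx e0; have e30 : 0 < e / 3 by rewrite divr_gt0.
have [p [wp hp _]] := h _ e30; have [C C0 hC] := peval_lipschitz K1 sx wp.
exists (e / 3 / (C + 1)); first by rewrite divr_gt0// ltr_wpDl.
move=> z; rewrite ltr_pdivlMr ?ltr_wpDl// => yz.
have s1 u : size (rcons x u) = n.+1 by rewrite size_rcons sx.
have := hp _ (s1 y); have := hp _ (s1 z); have := hC y z.
have := ndist_ge0 K1 y z.
set a := f1 (rcons x y); set b := f1 (rcons x z).
set a' := peval _ _ (rcons x y); set b' := peval _ _ (rcons x z).
move=> d0 h1 h2 h3; have -> : a - b = (a - a') + (a' - b') - (b - b') by ring.
have := ler_normB ((a - a') + (a' - b')) (b - b').
have := ler_normD (a - a') (a' - b'); nra.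
Qed.

(* equality of the types of two lists, in the sense of continuous logic *)
Definition matched n (x1 : seq J1) (x2 : seq J2) := [/\ size x1 = n, size x2 = n &
  forall f1 f2, definable K1 K2 n n f1 f2 -> f1 x1 = f2 x2].

Lemma matched_nil : same_sampling K1 K2 -> matched 0 [::] [::].
Proof. by move=> same; split=> // f1 f2; exact: definable_same_sampling. Qed.

(** The variable [y], of index [n], may occur in every position of the kernel, because it is
    integrated before the lists are compared. *)
Lemma matched_Rintegral n x1 x2 f1 f2 : matched n x1 x2 ->
  definable K1 K2 n n.+1 f1 f2 ->
  \int[kmu K1]_y f1 (rcons x1 y) = \int[kmu K2]_y f2 (rcons x2 y).
Proof. by move=> [_ _ h] /definable_Rintegral; exact: h. Qed.

End Matching.

Lemma matched_sym (R : realType) d1 d2 (J1 : measurableType d1) (J2 : measurableType d2)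
    (K1 : ternary_kernel J1 R) (K2 : ternary_kernel J2 R) n x1 x2 :
  matched K1 K2 n x1 x2 -> matched K2 K1 n x2 x1.
Proof. by move=> [s1 s2 h]; split => // f2 f1 /definable_sym/h. Qed.

(** * Extension of matched tuples *)

Section Extension.
Context {R : realType} d1 d2 (J1 : measurableType d1) (J2 : measurableType d2).
Context (K1 : ternary_kernel J1 R) (K2 : ternary_kernel J2 R).
Variables (n : nat) (x1 : seq J1) (x2 : seq J2).
Hypotheses (sx1 : size x1 = n) (sx2 : size x2 = n).
Local Notation definable := (definable K1 K2 n.+1 n.+1).

Lemma open_definable_gt f1 f2 (c : R) : definable f1 f2 ->
  open ([set y | c < f2 (rcons x2 y)] : set (nspace K2)).
Proof.
move=> df; apply/open_nspaceP => y /= cy.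
have cy0 : 0 < f2 (rcons x2 y) - c by rewrite subr_gt0.
have [r r0 h] := definable_continuous y (definable_sym df) sx2 cy0.
exists r => // z /h /ltr_normlP[_]; lra.
Qed.

Lemma open_definable_lt f1 f2 (c : R) : definable f1 f2 ->
  open ([set y | f1 (rcons x1 y) < c] : set (nspace K1)).
Proof.
move=> df; apply/open_nspaceP => y /= cy.
have cy0 : 0 < c - f1 (rcons x1 y) by rewrite subr_gt0.
have [r r0 h] := definable_continuous y df sx1 cy0.
exists r => // z /h /ltr_normlP[]; lra.
Qed.

(** Near each point of [C2], some nonnegative definable function that vanishes at [y1] exceeds 1. By
    compactness finitely many of them suffice, and their sum has the required properties. *)
Lemma separate_point_compact (y1 : J1) (C2 : set J2) :
  compact (C2 : set (nspace K2)) ->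
  (forall y2, C2 y2 -> exists f1 f2, definable f1 f2 /\
    f1 (rcons x1 y1) != f2 (rcons x2 y2)) ->
  exists h1 h2, [/\ definable h1 h2, forall x, 0 <= h1 x, forall x, 0 <= h2 x,
    h1 (rcons x1 y1) = 0 & forall y2, C2 y2 -> 1 <= h2 (rcons x2 y2)].
Proof.
move=> cC2 sep.
have /choice[F FP] : forall y2 : J2, exists h : (seq J1 -> R) * (seq J2 -> R),
    [/\ definable h.1 h.2, forall x, 0 <= h.1 x, forall x, 0 <= h.2 x,
      h.1 (rcons x1 y1) = 0 & C2 y2 -> 1 < h.2 (rcons x2 y2)].
  move=> y2; have [Cy|nCy] := pselect (C2 y2); last first.
    by exists (fun=> 0, fun=> 0); split => //=; exact: definable_cst.
  have [f1 [f2 [df]]] := sep _ Cy.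
  set a := f1 _; set b := f2 _ => ab.
  have ba : b - a != 0 by rewrite subr_eq0 eq_sym.
  (* This factor gives the squared difference the value 4 at [y2]; the strict inequality with 1 then
     persists on a neighborhood. *)
  pose c := (2 / (b - a)) ^+ 2.
  have c0 : 0 <= c by rewrite sqr_ge0.
  have dfa := definableB df (definable_cst _ _ _ _ a).
  exists (fun x => c * ((f1 x - a) * (f1 x - a)), fun x => c * ((f2 x - a) * (f2 x - a))).
  split => /=.
  - by apply: definableZ; exact: definableM.
  - by move=> x; rewrite mulr_ge0// -expr2 sqr_ge0.
  - by move=> x; rewrite mulr_ge0// -expr2 sqr_ge0.
  - by rewrite -/a subrr mulr0 mulr0.
  - move=> _; rewrite -/b (_ : c * _ = 4) ?ltr1n//.
    by rewrite /c; field.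
move: cC2; rewrite compact_cover => /(_ (nspace K2) C2
  (fun y2 => [set y | 1 < (F y2).2 (rcons x2 y)])) [].
- move=> y2 Cy2; have [df _ _ _ _] := FP y2; exact: open_definable_gt df.
- by move=> y2 Cy2; exists y2 => //=; have [_ _ _ _ /(_ Cy2)] := FP y2.
move=> D DC cov.
exists (fun x => \sum_(i <- finmap.enum_fset D) (F i).1 x), (fun x => \sum_(i <- finmap.enum_fset D) (F i).2 x).
split.
- by apply: definable_sum => i; have [] := FP i.
- by move=> x; apply: sumr_ge0 => i _; have [] := FP i.
- by move=> x; apply: sumr_ge0 => i _; have [] := FP i.
- by apply: big1 => i _; have [] := FP i.
- move=> y2 /cov[i /= iD /ltW h]; rewrite (big_rem i)//= (le_trans h)// lerDl.
  by apply: sumr_ge0 => j _; have [] := FP j.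
Qed.

(** For fixed [y1], truncation at 1 gives a function that equals 1 on [C2] and is below 1/2 near
    [y1]. A finite product over a cover of [C1] stays 1 on [C2] and is at most 1/2 on [C1]. *)
Lemma separate_compacts (C1 : set J1) (C2 : set J2) :
  compact (C1 : set (nspace K1)) -> compact (C2 : set (nspace K2)) ->
  (forall y1 y2, C1 y1 -> C2 y2 -> exists f1 f2, definable f1 f2 /\
    f1 (rcons x1 y1) != f2 (rcons x2 y2)) ->
  exists h1 h2, [/\ definable h1 h2, forall x, 0 <= h1 x <= 1, forall x, 0 <= h2 x <= 1,
    forall y1, C1 y1 -> h1 (rcons x1 y1) = 0 &
    forall y2, C2 y2 -> h2 (rcons x2 y2) = 1].
Proof.
move=> cC1 cC2 sep.
have /choice[F FP] : forall y1 : J1, exists h : (seq J1 -> R) * (seq J2 -> R),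
    [/\ definable h.1 h.2, forall x, 0 <= h.1 x <= 1, forall x, 0 <= h.2 x <= 1,
      C1 y1 -> h.1 (rcons x1 y1) < 1 / 2 &
      forall y2, C2 y2 -> h.2 (rcons x2 y2) = 1].
  move=> y1; have [Cy|nCy] := pselect (C1 y1); last first.
    by exists (fun=> 1, fun=> 1); split => //=; [exact: definable_cst|
      move=> ?; rewrite ler01 lexx..].
  have [h1 [h2 [dh h10 h20 h1y h2C]]] := separate_point_compact cC2 (fun y2 => sep y1 y2 Cy).
  exists (fun x => Num.min (h1 x) 1, fun x => Num.min (h2 x) 1); split => /=.
  - by apply: definable_min => //; exact: definable_cst.
  - by move=> x; rewrite le_min h10 ler01 ge_min lexx orbT.
  - by move=> x; rewrite le_min h20 ler01 ge_min lexx orbT.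
  - by move=> _; rewrite h1y min_l//; lra.
  - by move=> y2 /h2C; exact: min_r.
move: cC1; rewrite compact_cover => /(_ (nspace K1) C1
  (fun y1 => [set y | (F y1).1 (rcons x1 y) < 1 / 2])) [].
- by move=> y1 Cy1; have [df _ _ _ _] := FP y1; exact: open_definable_lt df.
- by move=> y1 Cy1; exists y1 => //=; have [_ _ _ /(_ Cy1)] := FP y1.
move=> D DC cov.
pose g1 x := \prod_(i <- finmap.enum_fset D) (F i).1 x; pose g2 x := \prod_(i <- finmap.enum_fset D) (F i).2 x.
have g10 x : 0 <= g1 x <= 1.
  have F01 j : 0 <= (F j).1 x <= 1 by have [_ /(_ x)] := FP j.
  apply/andP; split; first by apply: prodr_ge0 => j _; case/andP: (F01 j).
  by apply: prodr_ile1 => j _; exact: F01.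
have g20 x : 0 <= g2 x <= 1.
  have F01 j : 0 <= (F j).2 x <= 1 by have [_ _ /(_ x)] := FP j.
  apply/andP; split; first by apply: prodr_ge0 => j _; case/andP: (F01 j).
  by apply: prodr_ile1 => j _; exact: F01.
(* The map t -> max(0, 2t - 1) sends [0, 1/2] to 0 and fixes 1. *)
exists (fun x => Num.max 0 (2 * g1 x - 1)), (fun x => Num.max 0 (2 * g2 x - 1)).
split.
- apply: definable_max; first exact: definable_cst.
  apply: definableB; last exact: definable_cst.
  by apply: definableZ; apply: definable_prod => i _; have [] := FP i.
- by move=> x; rewrite le_max lexx/= ge_max ler01/=; have /andP[] := g10 x; lra.
- by move=> x; rewrite le_max lexx/= ge_max ler01/=; have /andP[] := g20 x; lra.
- move=> y1 /cov[i /= iD h]; rewrite max_l//.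
  suff : g1 (rcons x1 y1) <= 1 / 2 by lra.
  have F01 j : 0 <= (F j).1 (rcons x1 y1) <= 1 by have [_ /(_ (rcons x1 y1))] := FP j.
  rewrite /g1 (big_rem i)//= (le_trans _ (ltW h))// ler_piMr//.
    by case/andP: (F01 i).
  by apply: prodr_ile1 => j _; exact: F01.
- move=> y2 C2y; rewrite /g2 big1 ?max_r; first by lra.
    by lra.
  by move=> i _; have [_ _ _ _ ->] := FP i.
Qed.

(** Without a matched pair in [C1] and [C2], the separating functions have integrals at most 1 -
    mu1(C1) in the first kernel and at least 1 - mu2(~C2) in the second. These integrals are equal
    since [x1] and [x2] are matched, which contradicts the inequality between the measures. *)
Lemma matched_extend_compact (C1 : set J1) (C2 : set J2) :
  matched K1 K2 n x1 x2 -> measurable C1 -> measurable C2 ->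
  compact (C1 : set (nspace K1)) -> compact (C2 : set (nspace K2)) ->
  (kmu K2 (~` C2) < kmu K1 C1)%E ->
  exists y1 y2, [/\ C1 y1, C2 y2 & matched K1 K2 n.+1 (rcons x1 y1) (rcons x2 y2)].
Proof.
move=> mx mC1 mC2 cC1 cC2 C12; apply: contrapT => nex.
have [y1 y2 C1y C2y|h1 [h2 [dh h10 h20 hC1 hC2]]] := separate_compacts cC1 cC2.
  apply: contrapT => sep; apply: nex; exists y1, y2; split => //.
  split; [by rewrite size_rcons sx1|by rewrite size_rcons sx2|move=> f1 f2 df].
  by apply: contrapT => /eqP f12; apply: sep; exists f1, f2.
(* Separation is at level [n.+1], for continuity in the last variable; matching of [x1] and [x2]
   tests level [n], which is weaker. *)
have := matched_Rintegral mx (definable_leq (leqnSn n) dh).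
have [bh1 bh2 _] := dh.
have b1 := lmeas_rcons sx1 bh1; have b2 := lmeas_rcons sx2 bh2.
have mC2' := measurableC mC2.
move: C12; rewrite -!Rintegral_indicT// lte_fin.
have : \int[kmu K1]_y h1 (rcons x1 y) <= \int[kmu K1]_y (1 - \1_C1 y).
  apply: bmeas_le => //; first by apply: bmeasB; [exact: bmeas_cst|exact: bmeas_indic].
  move=> y; rewrite indicE; case: (boolP (y \in C1)) => [|_].
    by rewrite inE => /hC1 ->; rewrite subrr.
  by rewrite subr0; case/andP: (h10 (rcons x1 y)).
have : \int[kmu K2]_y (1 - \1_(~` C2) y) <= \int[kmu K2]_y h2 (rcons x2 y).
  apply: bmeas_le => //; first by apply: bmeasB; [exact: bmeas_cst|exact: bmeas_indic].
  move=> y; rewrite indicE in_setC; case: (boolP (y \in C2)) => [|_] /=.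
    by rewrite inE => /hC2 ->; rewrite subr0.
  by rewrite subrr; case/andP: (h20 (rcons x2 y)).
rewrite !bmeas_RintegralB; try exact: bmeas_cst; try exact: bmeas_indic.
rewrite !RintegralT_cst; lra.
Qed.

End Extension.

(** * Tightness of the measure of a pure kernel *)

Section Tightness.
Context {R : realType} d (J : measurableType d) (K : ternary_kernel J R).
Hypothesis pureK : pure_kernel K.
Local Notation mu := (kmu K).

Lemma open_measurable_nspace (U : set J) : open (U : set (nspace K)) -> measurable U.
Proof.
by move=> oU; have [_ _ _ _ ->] := pureK; exact: sub_sigma_algebra.
Qed.

Lemma closed_measurable_nspace (C : set J) : closed (C : set (nspace K)) -> measurable C.
Proof.
move=> cC; rewrite -(setCK C); apply: measurableC.
by apply: open_measurable_nspace; exact: closed_openC.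
Qed.

Lemma nspace_dense_seq : exists s : nat -> J, forall (x : J) (e : R), 0 < e ->
  exists i, ndist K (s i) x < e.
Proof.
have [_ _ [S cS dS] _ _] := pureK.
have S0 : S !=set0.
  by have [x [_ Sx]] := dS setT (ex_intro _ point I) openT; exists x.
have /pfcard_geP[S00|[s]] := cS; first by rewrite S00 in S0; case: S0.
exists s => x e e0.
have [||y [/= yx Sy]] := dS [set y | ndist K x y < e].
- by exists x; rewrite /= ndistxx.
- exact: open_ndist_ball.
have [i _ sy] : range s y by exact: (@surj _ _ _ _ s).
by exists i; rewrite sy ndist_sym.
Qed.

Lemma closed_ndist_ball (x : J) (r : R) :
  closed ([set y | ndist K x y <= r] : set (nspace K)).
Proof.
rewrite -[X in closed X]setCK; apply: open_closedC; apply/open_nspaceP => y /= /negP.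
rewrite -ltNge => xy; exists (ndist K x y - r); first by rewrite subr_gt0.
move=> z yz; apply/negP; rewrite -ltNge.
have := ndist_triangle K z x y; rewrite (ndist_sym K z y); lra.
Qed.

Lemma closed_ball_setU (s : nat -> J) (r : R) N :
  closed ((\bigcup_(i in `I_N) [set y | ndist K (s i) y <= r]) : set (nspace K)).
Proof.
by apply: closed_bigcup => [|i _]; [exact: finite_II|exact: closed_ndist_ball].
Qed.

(** Applied to finite unions of small balls, this makes an ultrafilter on a totally bounded set
    Cauchy. *)
Lemma ultra_bigcup T (F : set_system T) (A : nat -> set T) N : UltraFilter F ->
  F (\bigcup_(i in `I_N) A i) -> exists i, F (A i).
Proof.
move=> FU; elim: N => [|N IH].
  by rewrite II0 bigcup_set0 => F0; case: (filter_not_empty F F0).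
have [FA|FnA] := in_ultra_setVsetC (A N) FU; first by exists N.
move=> FAN; apply: IH; apply: filterS (filterI FAN FnA) => x [[i /= iN Aix] nANx].
exists i => //=; move: iN; rewrite ltnS leq_eqVlt => /orP[/eqP iN|//].
by rewrite iN in Aix.
Qed.

(* Ulam's theorem: finitely many balls of radius 1/(j+1) carry most of the
   mass, for each j; the intersection of these unions is totally bounded. *)
Lemma tight_nspace (e : R) : 0 < e -> exists C : set J,
  [/\ closed (C : set (nspace K)), compact (C : set (nspace K)) &
      (mu (~` C) <= e%:E)%E].
Proof.
move=> e0; have [s ds] := nspace_dense_seq.
pose B j N : set J := \bigcup_(i in `I_N) [set y | ndist K (s i) y <= j.+1%:R^-1].
have mB j N : measurable (B j N).
  exact/closed_measurable_nspace/closed_ball_setU.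
(* For fixed [j] the complements decrease to the empty set by density, so their measures tend to 0.
   The tolerances are chosen to sum to [e]. *)
have /choice[N BN] : forall j, exists N, (mu (~` B j N) <= (e / (2 ^ j.+1)%:R)%:E)%E.
  move=> j.
  have cap0 : \bigcap_N (~` B j N) = set0.
    rewrite -subset0 => y By.
    have [i si] := ds y (j.+1%:R^-1) ltac:(by rewrite invr_gt0).
    by apply: (By i.+1 I); exists i => //=; exact: ltW.
  have := @nonincreasing_cvg_mu _ _ _ mu (fun N => ~` B j N).
  rewrite cap0 measure0 => /(_ _ _ _ _) h.
  have ej0 : 0 < e / (2 ^ j.+1)%:R by rewrite divr_gt0// ltr0n expn_gt0.
  have /fine_cvg/cvgrPdist_le /(_ _ ej0)[N _ /(_ N (leqnn N))] :
      (mu \o (fun N => ~` B j N)) @ \oo --> 0%:E.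
    apply: h => //.
    - by rewrite (le_lt_trans (probability_le1 _ _)) ?ltry//; exact: measurableC.
    - by move=> N; exact: measurableC.
    - move=> m n mn; apply/subsetPset/subsetC => y [i /= im yi].
      by exists i => //=; exact: leq_trans mn.
  rewrite /= sub0r normrN ger0_norm ?fine_ge0// => hN.
  by exists N; rewrite -[leLHS]fineK ?lee_fin//; apply: fin_num_measure; exact: measurableC.
pose C := \bigcap_j B j (N j).
have cC : closed (C : set (nspace K)).
  by apply: closed_bigI => j _; exact: closed_ball_setU.
exists C; split => //.
(* For each [j] the ultrafilter contains one of the finitely many balls of radius 1/(j+1). It is
   therefore Cauchy and converges by completeness, to a point of [C] since [C] is closed. *)
- rewrite compact_ultra => F FU FC.
  have cF : cauchy F.
    apply/cauchy_ballP => r r0.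
    have [j /= jr] : exists j, 0 + j.+1%:R^-1 < r / 2 by apply: ltr_add_invr; rewrite divr_gt0.
    have [i Fi] : exists i, F [set y : nspace K | ndist K (s i) y <= j.+1%:R^-1].
      apply: (@ultra_bigcup _ _ _ (N j)); apply: filterS FC => y; exact.
    exists ([set y : nspace K | ndist K (s i) y <= j.+1%:R^-1],
            [set y : nspace K | ndist K (s i) y <= j.+1%:R^-1]) => //.
    move=> [y z] [/= siy siz]; rewrite nspace_ballE.
    rewrite (le_lt_trans (ndist_triangle K (s i) y z))// ndist_sym.
    by move: jr; rewrite add0r => jr; rewrite (le_lt_trans (lerD siy siz))// [ltRHS]splitr ltrD.
  have [_ cauchy_cvg _ _ _] := pureK.
  have cvF := cauchy_cvg F _ cF.
  exists (lim F); split; last exact: cvF.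
  by apply: cC => V /cvF FV; exact: filter_ex (filterI FC FV).
- rewrite /C setC_bigcap; apply: (le_trans _ (epsilon_trick0 _ (ltW e0))).
  apply: (le_trans (le_mu_bigcup _ _ _)).
  + by move=> j; exact: measurableC.
  + by apply: bigcupT_measurable => j; exact: measurableC.
  + by apply: lee_nneseries => [//|j _ /=]; exact: BN.
Qed.

End Tightness.

(** By purity the closed ball [D] around [y0] has positive measure 3b. If compact sets [C1] and [C2]
    miss at most b of the mass, the part of [D] in [C1] has measure at least 2b, more than the
    complement of [C2]. *)
Lemma matched_extend (R : realType) d1 d2 (J1 : measurableType d1) (J2 : measurableType d2)
    (K1 : ternary_kernel J1 R) (K2 : ternary_kernel J2 R) n x1 x2 (y0 : J1) (r : R) :
  pure_kernel K1 -> pure_kernel K2 -> matched K1 K2 n x1 x2 -> 0 < r ->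
  exists y1 y2, ndist K1 y0 y1 <= r /\
    matched K1 K2 n.+1 (rcons x1 y1) (rcons x2 y2).
Proof.
move=> pK1 pK2 mx r0.
pose D : set J1 := [set y | ndist K1 y0 y <= r].
have cD : closed (D : set (nspace K1)) by exact: closed_ndist_ball.
have mD : measurable D by exact: (closed_measurable_nspace pK1).
have D0 : (0 < kmu K1 D)%E.
  have [_ _ _ pos _] := pK1.
  apply: (@lt_le_trans _ _ (kmu K1 [set y | ndist K1 y0 y < r])).
    apply: pos; first exact: open_ndist_ball.
    by exists y0; rewrite /= ndistxx.
  apply: le_measure; rewrite ?inE//; last by move=> y /ltW.
  by apply: (open_measurable_nspace pK1); exact: open_ndist_ball.
have fD : kmu K1 D \is a fin_num by exact: fin_num_measure.
pose b := fine (kmu K1 D) / 3.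
have b0 : 0 < b.
  by rewrite /b divr_gt0// fine_gt0// D0 ltey_eq fD.
have [C1 [cC1 kC1 C1b]] := tight_nspace pK1 b0.
have [C2 [cC2 kC2 C2b]] := tight_nspace pK2 b0.
have mC1 := closed_measurable_nspace pK1 cC1.
have mC2 := closed_measurable_nspace pK2 cC2.
have mCD : measurable (C1 `&` D) by exact: measurableI.
have [sx1 sx2 _] := mx.
have [|y1 [y2 [[_ y1D] _ my]]] := matched_extend_compact sx1 sx2 mx mCD mC2
  (subclosed_compact (closedI cC1 cD) kC1 (@subIsetl _ _ _)) kC2; last by exists y1, y2.
apply: (le_lt_trans C2b).
have : (kmu K1 D <= kmu K1 (C1 `&` D) + kmu K1 (~` C1))%E.
  apply: le_trans (measureU2 _ mCD (measurableC mC1)).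
  apply: le_measure; rewrite ?inE//; first exact: measurableU _ _ (measurableC mC1).
  by move=> y Dy; have [C1y|nC1y] := pselect (C1 y); [left|right].
rewrite -(fineK fD) (_ : fine _ = b * 3); last by rewrite /b; lra.
have f1 : kmu K1 (C1 `&` D) \is a fin_num by exact: fin_num_measure.
have f2 : kmu K1 (~` C1) \is a fin_num.
  by apply: fin_num_measure; exact: measurableC.
move: C1b; rewrite -(fineK f1) -(fineK f2) -EFinD !lee_fin lte_fin; lra.
Qed.

(** * Back and forth *)

Section BackAndForth.
Context {R : realType} d1 d2 (J1 : measurableType d1) (J2 : measurableType d2).
Context (K1 : ternary_kernel J1 R) (K2 : ternary_kernel J2 R).
Hypotheses (pureK1 : pure_kernel K1) (pureK2 : pure_kernel K2).

(** One step forth, from [a1], followed by one step back, from [a2], with the kernels exchanged. *)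
Lemma matched_extend2 n x1 x2 (a1 : J1) (a2 : J2) (r : R) :
  matched K1 K2 n x1 x2 -> 0 < r ->
  exists y1 y2 z1 z2, [/\ ndist K1 a1 y1 <= r, ndist K2 a2 z2 <= r &
    matched K1 K2 n.+2 (rcons (rcons x1 y1) z1) (rcons (rcons x2 y2) z2)].
Proof.
move=> mx r0; have [y1 [y2 [a1y1 my]]] := matched_extend a1 pureK1 pureK2 mx r0.
have [z2 [z1 [a2z2 mz]]] := matched_extend a2 pureK2 pureK1 (matched_sym my) r0.
by exists y1, y2, z1, z2; split => //; exact: matched_sym.
Qed.

Hypothesis same : same_sampling K1 K2.

Lemma dense_matched_sequences : exists (x1 : nat -> J1) (x2 : nat -> J2),
  [/\ forall n, matched K1 K2 n.*2 (mkseq x1 n.*2) (mkseq x2 n.*2),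
    forall x (e : R), 0 < e -> exists j, ndist K1 (x1 j) x < e &
    forall x (e : R), 0 < e -> exists j, ndist K2 (x2 j) x < e].
Proof.
have [s1 ds1] := nspace_dense_seq pureK1; have [s2 ds2] := nspace_dense_seq pureK2.
(* Stage [i] decodes a pair: the index of the dense point to approach and the precision. Values that
   code no pair fall back on (0, 0). *)
pose target i : nat * nat := odflt (0, 0)%N (unpickle i).
pose r i : R := (target i).2.+1%:R^-1.
have r0 i : 0 < r i by rewrite invr_gt0.
(* The extension becomes a function on all states, so that the recursion below carries no proof; on
   unmatched lists it returns arbitrary points. *)
have /choice[F FP] : forall st : nat * (seq J1 * seq J2), exists uv : (J1 * J1) * (J2 * J2),
    forall n, matched K1 K2 n st.2.1 st.2.2 ->
    [/\ ndist K1 (s1 (target st.1).1) uv.1.1 <= r st.1,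
        ndist K2 (s2 (target st.1).1) uv.2.2 <= r st.1 &
        matched K1 K2 n.+2 (rcons (rcons st.2.1 uv.1.1) uv.1.2)
                           (rcons (rcons st.2.2 uv.2.1) uv.2.2)].
  move=> [i [x1 x2]] /=.
  have [[n mn]|nm] := pselect (exists n, matched K1 K2 n x1 x2); last first.
    by exists (point, point, (point, point)) => n mn; case: nm; exists n.
  have [y1 [y2 [z1 [z2 [h1 h2 h3]]]]] :=
    matched_extend2 (s1 (target i).1) (s2 (target i).1) mn (r0 i).
  exists ((y1, z1), (y2, z2)) => m mm.
  have [<- _ _] := mm; have [sn _ _] := mn.
  by rewrite sn.
pose st := fix st i : seq J1 * seq J2 := if i is i'.+1 then
  let uv := F (i', st i') in
  (rcons (rcons (st i').1 uv.1.1) uv.1.2, rcons (rcons (st i').2 uv.2.1) uv.2.2)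
  else ([::], [::]).
have mst i : matched K1 K2 i.*2 (st i).1 (st i).2.
  elim: i => [|i IH]; first exact: matched_nil.
  by have [_ _] := FP (i, st i) _ IH.
have size1 i : size (st i).1 = i.*2 by have [] := mst i.
have size2 i : size (st i).2 = i.*2 by have [] := mst i.
(* Stages only append, and the lists of stage j+1 have length 2(j+1) > j, so later stages do not
   change the entry read here. *)
pose x1 j := nth point (st j.+1).1 j; pose x2 j := nth point (st j.+1).2 j.
have nthS i j : (j < i.*2)%N ->
    nth point (st i.+1).1 j = nth point (st i).1 j /\
    nth point (st i.+1).2 j = nth point (st i).2 j.
  by move=> ji; rewrite /= !nth_rcons !size_rcons size1 size2 ji !(ltn_trans ji).
have nthle i i' j : (j < i.*2)%N -> (i <= i')%N ->
    nth point (st i').1 j = nth point (st i).1 j /\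
    nth point (st i').2 j = nth point (st i).2 j.
  move=> ji; elim: i' => [|i' IH]; first by rewrite leqn0 => /eqP <-.
  rewrite leq_eqVlt => /predU1P[<-//|]; rewrite ltnS => ii'.
  have [<- <-] := IH ii'; apply: nthS; rewrite (leq_trans ji)// leq_double//.
have nthx i j : (j < i.*2)%N ->
    x1 j = nth point (st i).1 j /\ x2 j = nth point (st i).2 j.
  move=> ji; have jj : (j < j.+1.*2)%N by rewrite doubleS ltnS -addnn leqW ?leq_addr.
  have [ij|/ltnW ij] := leqP i j.+1.
    by have [e1 e2] := nthle _ _ _ ji ij; rewrite /x1 /x2 e1 e2.
  by have [e1 e2] := nthle _ _ _ jj ij; rewrite /x1 /x2 e1 e2.
have stE i : st i = (mkseq x1 i.*2, mkseq x2 i.*2).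
  rewrite [LHS]surjective_pairing; congr (_, _).
    apply: (@eq_from_nth _ point) => [|j]; first by rewrite size_mkseq.
    by rewrite size1 => ji; rewrite nth_mkseq//; have [] := nthx _ _ ji.
  apply: (@eq_from_nth _ point) => [|j]; first by rewrite size_mkseq.
  by rewrite size2 => ji; rewrite nth_mkseq//; have [] := nthx _ _ ji.
(* Stage [i] puts its approximation in [J1] at index 2i and its approximation in [J2] at index 2i +
   1. *)
have x1E i : x1 i.*2 = (F (i, st i)).1.1.
  have ii : (i.*2 < i.+1.*2)%N by rewrite ltn_double.
  have [-> _] := nthx _ _ ii.
  by rewrite /= !nth_rcons size_rcons size1 ltnSn ltnn eqxx.
have x2E i : x2 i.*2.+1 = (F (i, st i)).2.2.
  have ii : (i.*2.+1 < i.+1.*2)%N by rewrite doubleS.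
  have [_ ->] := nthx _ _ ii.
  by rewrite /= nth_rcons size_rcons size2 ltnn eqxx.
(* Every dense point is targeted with every precision, since all pairs have a code. *)
have close (e : R) a : 0 < e -> exists i, target i = (a, (target i).2) /\ r i < e.
  move=> e0; have [b /=] := @ltr_add_invr R 0 e e0; rewrite add0r => be.
  by exists (pickle (a, b)); rewrite /r /target pickleK.
exists x1, x2; split => [n|x e e0|x e e0]; first by have := mst n; rewrite stE.
- have e20 : 0 < e / 2 by rewrite divr_gt0.
  have [a ax] := ds1 x _ e20; have [i [ti ri]] := close _ a e20.
  have [h _ _] := FP (i, st i) _ (mst i); exists i.*2; rewrite x1E.
  rewrite /= ti ndist_sym/= in h.
  by rewrite (le_lt_trans (ndist_triangle K1 (s1 a) _ _))// [ltRHS]splitr ltrD// (le_lt_trans h).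
- have e20 : 0 < e / 2 by rewrite divr_gt0.
  have [a ax] := ds2 x _ e20; have [i [ti ri]] := close _ a e20.
  have [_ h _] := FP (i, st i) _ (mst i); exists i.*2.+1; rewrite x2E.
  rewrite /= ti ndist_sym/= in h.
  by rewrite (le_lt_trans (ndist_triangle K2 (s2 a) _ _))// [ltRHS]splitr ltrD// (le_lt_trans h).
Qed.

End BackAndForth.

(** * The isometry *)

Section ExtendIsometry.
Context {R : realType} d1 d2 (J1 : measurableType d1) (J2 : measurableType d2).
Context (K1 : ternary_kernel J1 R) (K2 : ternary_kernel J2 R).
Variables (x1 : nat -> J1) (x2 : nat -> J2).

(** For dense sequences in pure kernels this is the graph of the isometry that extends [x1 i] to
    [x2 i]. *)
Definition corresponding (z1 : J1) (z2 : J2) :=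
  forall i, ndist K2 (x2 i) z2 = ndist K1 (x1 i) z1.

Hypotheses (pureK2 : pure_kernel K2).
Hypothesis dense1 : forall x (e : R), 0 < e -> exists j, ndist K1 (x1 j) x < e.
Hypothesis iso : forall i j, ndist K2 (x2 i) (x2 j) = ndist K1 (x1 i) (x1 j).

Lemma ndist_lipschitz (u v w : J2) : `|ndist K2 u v - ndist K2 u w| <= ndist K2 v w.
Proof.
have := ndist_triangle K2 v u w; have := ndist_triangle K2 w u v.
rewrite (ndist_sym K2 w v) ler_norml => h1 h2; apply/andP; split; lra.
Qed.

(** Terms of [x1] converging to [z1] have counterparts in [x2] that form a Cauchy sequence by [iso];
    its limit is the required point. *)
Lemma corresponding_exists z1 : exists z2, corresponding z1 z2.
Proof.
have /choice[a aP] : forall k : nat, exists j, ndist K1 (x1 j) z1 < k.+1%:R^-1.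
  by move=> k; apply: dense1; rewrite invr_gt0.
have small (e : R) : 0 < e -> \forall k \near \oo, ndist K1 (x1 (a k)) z1 < e.
  move=> e0; have := near_infty_natSinv_lt (PosNum e0).
  by apply: filterS => k /=; exact: lt_trans.
pose u k : nspace K2 := x2 (a k).
have cu : cauchy (u @ \oo).
  apply/cauchy_ballP => e e0; have e20 : 0 < e / 2 by rewrite divr_gt0.
  exists (u @` [set k | ndist K1 (x1 (a k)) z1 < e / 2],
          u @` [set k | ndist K1 (x1 (a k)) z1 < e / 2]).
    by split; apply: filterS (small _ e20) => k ke; exists k.
  move=> [_ _] [/= [k ke <-] [l le <-]]; rewrite nspace_ballE iso.
  rewrite (le_lt_trans (ndist_triangle K1 z1 _ _))// [ltRHS]splitr ltrD//.
  by rewrite ndist_sym.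
have [_ cauchy_cvg _ _ _] := pureK2.
have uz2 : cvg (u @ \oo) by exact: cauchy_cvg.
set z2 := lim _ in uz2; exists z2 => i; apply/eqP; rewrite -subr_eq0 -normr_le0.
apply/ler_addgt0Pr => e e0; rewrite add0r; have e20 : 0 < e / 2 by rewrite divr_gt0.
have uball : \forall k \near \oo, ball (z2 : nspace K2) (e / 2) (u k).
  exact: uz2 _ (nbhsx_ballx (z2 : nspace K2) _ e20).
have [k [/= ku ke]] := filter_ex (filterI uball (small _ e20)).
rewrite nspace_ballE in ku.
have h1 := ndist_lipschitz (x2 i) z2 (x2 (a k)).
have h2 : `|ndist K1 (x1 i) (x1 (a k)) - ndist K1 (x1 i) z1| <= ndist K1 (x1 (a k)) z1.
  have := ndist_triangle K1 (x1 (a k)) (x1 i) z1.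
  have := ndist_triangle K1 z1 (x1 i) (x1 (a k)).
  rewrite (ndist_sym K1 z1) ler_norml => h3 h4; apply/andP; split; lra.
rewrite -iso in h2.
rewrite (le_trans (ler_distD (ndist K2 (x2 i) (x2 (a k))) _ _))// [e in leRHS]splitr.
by rewrite lerD// ?(le_trans h1) ?(le_trans h2)// ltW.
Qed.

(** If [x1 j] is close to [z1], then [x2 j] is equally close to [z2], so both distances are close to
    the common distance from the [j]-th terms. *)
Lemma corresponding_ndist z1 z2 w1 w2 : corresponding z1 z2 -> corresponding w1 w2 ->
  ndist K2 z2 w2 = ndist K1 z1 w1.
Proof.
move=> zz ww; apply/eqP; rewrite -subr_eq0 -normr_le0.
apply/ler_addgt0Pr => e e0; rewrite add0r; have e20 : 0 < e / 2 by rewrite divr_gt0.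
have [j jz] := dense1 z1 e20.
have := ndist_triangle K2 (x2 j) z2 w2; have := ndist_triangle K2 z2 (x2 j) w2.
have := ndist_triangle K1 (x1 j) z1 w1; have := ndist_triangle K1 z1 (x1 j) w1.
rewrite (ndist_sym K2 z2 (x2 j)) (ndist_sym K1 z1 (x1 j)) zz ww ler_norml.
by move=> *; apply/andP; split; lra.
Qed.

End ExtendIsometry.

Lemma corresponding_sym (R : realType) d1 d2 (J1 : measurableType d1)
    (J2 : measurableType d2) (K1 : ternary_kernel J1 R) (K2 : ternary_kernel J2 R)
    (x1 : nat -> J1) (x2 : nat -> J2) z1 z2 :
  corresponding K1 K2 x1 x2 z1 z2 -> corresponding K2 K1 x2 x1 z2 z1.
Proof. by move=> h i; rewrite h. Qed.

(** * Finite intersections of balls as generators of the measurable sets *)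

Section Boxes.
Context {R : realType} d (J : measurableType d) (K : ternary_kernel J R).
Hypothesis pureK : pure_kernel K.
Variable x : nat -> J.
Hypothesis dense_x : forall z (e : R), 0 < e -> exists j, ndist K (x j) z < e.
Implicit Types s : seq (nat * R).

(** The code [s] lists indices of centers and radii; the same code thus names corresponding boxes in
    both spaces. *)
Definition box s : set J := [set y | forall q, q \in s -> ndist K (x q.1) y < q.2].

Lemma box_cat s s' : box (s ++ s') = box s `&` box s'.
Proof.
apply/seteqP; split => [y h|y [h h'] q]; last first.
  by rewrite mem_cat => /orP[/h|/h'].
by split => q qs; apply: h; rewrite mem_cat qs ?orbT.
Qed.

Lemma box_nil : box [::] = setT.
Proof. by apply/seteqP; split. Qed.

Lemma box_seq1 i r : box [:: (i, r)] = [set y | ndist K (x i) y < r].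
Proof.
apply/seteqP; split => [y /(_ (i, r))/=|y h q]; first by rewrite mem_head; apply.
by rewrite inE => /eqP ->.
Qed.

Lemma measurable_box s : measurable (box s).
Proof.
elim: s => [|[i r] s IH]; first by rewrite box_nil.
rewrite -cat1s box_cat box_seq1; apply: measurableI => //.
by apply: (open_measurable_nspace pureK); exact: open_ndist_ball.
Qed.

(** Measurable sets are generated by open sets, by purity, and an open set is a countable union of
    balls centered at the dense sequence with radii 1/(k+1). *)
Lemma measurable_gen_box : (measurable : set (set J)) = <<s range box >>.
Proof.
apply/seteqP; split; last first.
  by apply: smallest_sub; [exact: sigma_algebra_measurable|move=> _ [s _ <-]; exact: measurable_box].
have [_ _ _ _ ->] := pureK; apply: smallest_sub; first exact: smallest_sigma_algebra.
move=> U /open_nspaceP oU.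
have -> : U = \bigcup_(q in [set q : nat * nat | box [:: (q.1, q.2.+1%:R^-1)] `<=` U])
    box [:: (q.1, q.2.+1%:R^-1)].
  apply/seteqP; split => [y Uy|y [q /= qU]]; last exact: qU.
  have [e e0 eU] := oU _ Uy; have e20 : 0 < e / 2 by rewrite divr_gt0.
  have [k /=] := @ltr_add_invr R 0 _ e20; rewrite add0r => ke.
  have [j jy] := dense_x y (e := k.+1%:R^-1) ltac:(by rewrite invr_gt0).
  exists (j, k) => /=; last by rewrite box_seq1.
  rewrite box_seq1 => z /= jz; apply: eU.
  rewrite (le_lt_trans (ndist_triangle K (x j) _ _))// [ltRHS]splitr.
  by rewrite ltrD// ?(lt_trans jz)// ndist_sym (lt_trans jy).
rewrite bigcup_mkcond.
apply: (@countable_bigcupT_measurable _ (g_sigma_algebraType (range (box)))) => // q.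
case: ifPn => _; last exact: (@measurable0 _ (g_sigma_algebraType (range box))).
by apply: sub_sigma_algebra; exists [:: (q.1, q.2.+1%:R^-1)].
Qed.

Lemma range_box_setI : setI_closed (range box).
Proof. by move=> _ _ [s _ <-] [s' _ <-]; exists (s ++ s') => //; rewrite box_cat. Qed.

End Boxes.

(** * Functions with vanishing integrals over rectangles of boxes *)

Section ZeroOnRectangles.
Context {R : realType} d (J : measurableType d) (K : ternary_kernel J R).
Hypothesis pureK : pure_kernel K.
Variable x : nat -> J.
Hypothesis dense_x : forall z (e : R), 0 < e -> exists j, ndist K (x j) z < e.
Local Notation mu2 := (kmu K \x kmu K)%E.
Local Notation box := (box K x).
Local Notation rectangles := [set box q.1 `*` box q.2 | q in [set: seq (nat * R) * seq (nat * R)]].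

Lemma measurable_rectangle q : measurable (box q.1 `*` box q.2).
Proof. by apply: measurableX; exact: measurable_box. Qed.

(** Both projections are measurable for the generated sigma-algebra: the empty code gives the whole
    space as the other side. *)
Lemma measurable_gen_rectangles :
  (measurable : set (set (J * J))) `<=` <<s rectangles >>.
Proof.
pose T := g_sigma_algebraType (rectangles : set (set (J * J))).
rewrite measurable_prod_measurableType; apply: smallest_sub.
  exact: smallest_sigma_algebra.
have gen := measurable_gen_box pureK dense_x.
have mfst : @measurable_fun _ _ T J setT fst.
  apply: (@measurability _ _ T J _ _ _ gen) => _ [_ [s _ <-] <-]; apply: sub_sigma_algebra.
  exists (s, [::]) => //=; rewrite box_nil setTI.
  by apply/seteqP; split => [p []|p].
have msnd : @measurable_fun _ _ T J setT snd.
  apply: (@measurability _ _ T J _ _ _ gen) => _ [_ [s _ <-] <-]; apply: sub_sigma_algebra.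
  exists ([::], s) => //=; rewrite box_nil setTI.
  by apply/seteqP; split => [p []|p].
move=> _ [A mA [B mB <-]].
have -> : A `*` B = ([set: T] `&` fst @^-1` A) `&` ([set: T] `&` snd @^-1` B).
  by apply/seteqP; split => [p [? ?]|p [[_ ?] [_ ?]]].
by apply: (@measurableI _ T); [exact: mfst|exact: msnd].
Qed.

Lemma rectangles_setI : setI_closed rectangles.
Proof.
move=> _ _ [q _ <-] [q' _ <-]; exists (q.1 ++ q'.1, q.2 ++ q'.2) => //=.
by rewrite !box_cat setXI.
Qed.

(** The measurable sets on which [h] has integral 0 form a Dynkin system that contains the
    rectangles, a pi-system; hence they are all measurable sets. The set where [h] is nonnegative
    and its complement then give the integral of |h|. *)
Lemma Rintegral_rectangles_eq0 (h : J * J -> R) : bounded_measurable h ->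
  (forall s s', \int[mu2]_p (h p * \1_(box s `*` box s') p) = 0) ->
  \int[mu2]_p `|h p| = 0.
Proof.
move=> bh h0.
have bI (E : set (J * J)) : measurable E -> bounded_measurable (fun p => h p * \1_E p).
  by move=> mE; apply: bmeasM => //; exact: bmeas_indic.
pose H := [set E : set (J * J) | measurable E /\ \int[mu2]_p (h p * \1_E p) = 0].
have hT : \int[mu2]_p h p = 0.
  have := h0 [::] [::]; rewrite box_nil setXTT => <-.
  by apply: eq_Rintegral => p _; rewrite indicT mulr1.
have dH : dynkin H.
  split.
  - split => //; rewrite -[RHS]hT.
    by apply: eq_Rintegral => p _; rewrite indicT mulr1.
  - move=> E [mE E0]; split; first exact: measurableC.
    transitivity (\int[mu2]_p (h p - h p * \1_E p)).
      apply: eq_Rintegral => p _; rewrite !indicE in_setC.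
      by case: (p \in E); rewrite /= ?mulr1 ?mulr0 ?subrr ?subr0.
    by rewrite bmeas_RintegralB ?hT ?E0 ?subrr//; exact: bI.
  - move=> F tF HF; split; first by apply: bigcupT_measurable => i; have [] := HF i.
    have mF i : measurable (F i) by have [] := HF i.
    (* Finite unions follow by additivity, the countable union by dominated convergence. *)
    pose U n := \bigcup_(i in `I_n) F i.
    have mU n : measurable (U n) by apply: bigcup_measurable => i _.
    have U0 n : \int[mu2]_p (h p * \1_(U n) p) = 0.
      elim: n => [|n IH].
        rewrite /U II0 bigcup_set0.
        by under eq_Rintegral do rewrite indic0 mulr0; rewrite RintegralT_cst.
      have -> : \int[mu2]_p (h p * \1_(U n.+1) p) =
          \int[mu2]_p (h p * \1_(U n) p + h p * \1_(F n) p).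
        apply: eq_Rintegral => p _; rewrite -mulrDr; congr (_ * _).
        rewrite !indicE; have [pn|pn] := boolP (p \in F n).
          rewrite (_ : p \in U n.+1); last first.
            by rewrite inE in pn; rewrite inE; exists n => //=.
          rewrite (_ : p \in U n = false) ?add0r//; apply/negP; rewrite inE => -[i /= ni pi].
          rewrite inE in pn; have := tF i n I I (ex_intro _ p (conj pi pn)).
          by move=> ein; rewrite ein ltnn in ni.
        rewrite addr0; congr (_%:R); congr nat_of_bool; apply/idP/idP; rewrite !inE.
          move=> -[i /= iS pi]; exists i => //=; move: iS.
          rewrite ltnS leq_eqVlt => /predU1P[ein|//]; move: pn; rewrite -ein => /negP.
          by rewrite inE.
        by move=> -[i /= iS pi]; exists i => //=; exact: ltnW.
      rewrite bmeas_RintegralD; [|exact: bI|exact: bI].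
      by rewrite IH; have [_ ->] := HF n; rewrite addr0.
    have [mh [M hM]] := bh.
    have [|||_ cU] := @bmeas_dominated R _ _ mu2 (fun n p => h p * \1_(U n) p)
      (fun p => h p * \1_(\bigcup_i F i) p) M.
    + by move=> n; have [] := bI _ (mU n).
    + move=> n p; rewrite normrM indicE; case: (_ \in _).
        by rewrite normr1 mulr1.
      by rewrite normr0 mulr0 (le_trans _ (hM p)).
    + move=> p; apply: cvgMr; have [[i _ Fip]|nF] := pselect ((\bigcup_i F i) p).
        apply: cvg_near_cst; exists i.+1 => // n /= iS.
        rewrite !indicE; congr (nat_of_bool _)%:R; rewrite !mem_set//; last by exists i.
        by exists i.
      apply: cvg_near_cst; apply: nearW => n; rewrite !indicE !memNset//.
      by move=> [i _ Fip]; apply: nF; exists i.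
    apply/esym/(cvg_unique _ _ cU) => //.
    rewrite (_ : (fun n => _) = cst 0); first exact: cvg_cst.
    by apply/funext => n; exact: U0.
have allH E : measurable E -> \int[mu2]_p (h p * \1_E p) = 0.
  move=> /measurable_gen_rectangles; rewrite -setI_closed_g_dynkin_g_sigma_algebra; last exact: rectangles_setI.
  move=> /(_ H); case=> //; split => // _ [q _ <-]; split; last exact: h0.
  exact: measurable_rectangle.
have mP : measurable [set p | 0 <= h p].
  have [mh _] := bh.
  have := mh measurableT _ (measurable_itv `[0, +oo[); rewrite setTI.
  by rewrite (_ : _ @^-1` _ = [set p | 0 <= h p])//; apply/seteqP; split => p /=; rewrite in_itv/= andbT.
transitivity (\int[mu2]_p (h p * \1_[set p | 0 <= h p] p - h p * \1_(~` [set p | 0 <= h p]) p)).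
  apply: eq_Rintegral => p _; rewrite !indicE in_setC; have [hp|hp] := leP 0 (h p).
    by rewrite mem_set//= mulr1 mulr0 subr0 ger0_norm.
  by rewrite memNset/= ?mulr0 ?mulr1 ?sub0r ?ltr0_norm//= leNgt hp.
rewrite bmeas_RintegralB ?allH ?subrr//; [exact: measurableC|exact: bI|].
by apply: bI; exact: measurableC.
Qed.

End ZeroOnRectangles.

(** * Integrals over boxes *)

Section BoxLaw.
Context {R : realType} d1 d2 (J1 : measurableType d1) (J2 : measurableType d2).
Context (K1 : ternary_kernel J1 R) (K2 : ternary_kernel J2 R).

Lemma ndist_Rintegral_entry d (J : measurableType d) (K : ternary_kernel J R) n i j x :
  size x = n -> (i < n)%N -> (j < n)%N ->
  \int[kmu K]_y \int[kmu K]_z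
    `|entry K (rcons (rcons x y) z) (i, n, n.+1) - entry K (rcons (rcons x y) z) (j, n, n.+1)| =
  ndist K (nth point x i) (nth point x j).
Proof.
move=> sx ni nj; rewrite /ndist bmeas_fubini1; last exact: bmeas_section_dist.
apply: eq_Rintegral => y _; apply: eq_Rintegral => z _.
rewrite /entry /= !nth_rcons !size_rcons sx ltnn eqxx ltnSn ltnn eqxx.
by rewrite !ltnS (ltnW ni) (ltnW nj) ni nj.
Qed.

(** The distance integrates two new variables, of indices [n] and [n.+1], in the second and third
    positions; as [k <= n], these positions are open to them. *)
Lemma definable_ndist k n i j : (k <= n)%N -> (i < n)%N -> (j < n)%N ->
  definable K1 K2 k n (fun x => ndist K1 (nth point x i) (nth point x j))
                      (fun x => ndist K2 (nth point x i) (nth point x j)).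
Proof.
move=> kn ni nj; have dent i' : (i' < n)%N -> definable K1 K2 k n.+2
    (fun x => entry K1 x (i', n, n.+1)) (fun x => entry K2 x (i', n, n.+1)).
  by move=> ni'; apply: definable_entry; lia.
apply: eq_definable (definable_Rintegral (definable_Rintegral
    (definable_abs (definableB (dent _ ni) (dent _ nj))))) => x sx;
  exact: ndist_Rintegral_entry.
Qed.

(** A definable approximation of the indicator of a box: the ramps t -> min(1, k max(0, t)) tend to
    the indicator of t > 0. *)
Definition bump d (J : measurableType d) (K : ternary_kernel J R) k (s : seq (nat * R))
    (x : nat -> J) y :=
  \prod_(q <- s) Num.min 1 (k%:R * Num.max 0 (q.2 - ndist K (x q.1) y)).

Lemma bump01 d (J : measurableType d) (K : ternary_kernel J R) k s (x : nat -> J) y :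
  0 <= bump K k s x y <= 1.
Proof.
have h (q : nat * R) : 0 <= Num.min 1 (k%:R * Num.max 0 (q.2 - ndist K (x q.1) y)) <= 1.
  by rewrite le_min ler01 ge_min lexx/= andbT mulr_ge0// le_max lexx.
apply/andP; split; first by apply: prodr_ge0 => q _; case/andP: (h q).
by apply: prodr_ile1 => q _; exact: h.
Qed.

Lemma bump_indic d (J : measurableType d) (K : ternary_kernel J R) s (x : nat -> J) y :
  \forall k \near \oo, bump K k s x y = \1_(box K x s) y.
Proof.
elim: s => [|[i r] s IH].
  by apply: nearW => k; rewrite /bump big_nil box_nil indicT.
have h : \forall k \near \oo, Num.min 1 (k%:R * Num.max 0 (r - ndist K (x i) y)) =
    \1_(box K x [:: (i, r)]) y.
  rewrite box_seq1; have [yr|ry] := ltP (ndist K (x i) y) r; last first.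
    apply: nearW => k; rewrite max_l ?subr_le0// mulr0 min_r// indicE memNset//=.
    by apply/negP; rewrite -leNgt.
  have ry0 : 0 < r - ndist K (x i) y by rewrite subr_gt0.
  have := near_infty_natSinv_lt (PosNum ry0); move=> [N _ hN].
  (* Starting at [N.+1] excludes [k = 0], for which the ramp vanishes. *)
  exists N.+1 => // -[//|k] /= Nk.
  rewrite indicE mem_set// max_r ?ltW// min_l//.
  by rewrite -ler_pdivrMl// mulr1 ltW//; exact: hN.
apply: filterS2 h IH => k h IH; rewrite /bump big_cons /= h -/(bump K k s x y) IH.
by rewrite -[(i, r) :: s]cat1s box_cat indicI.
Qed.

Variables (x1 : nat -> J1) (x2 : nat -> J2).
Hypotheses (pureK1 : pure_kernel K1) (pureK2 : pure_kernel K2).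
Hypothesis matched12 : forall n, matched K1 K2 n.*2 (mkseq x1 n.*2) (mkseq x2 n.*2).

Lemma matched_ndist i j : ndist K2 (x2 i) (x2 j) = ndist K1 (x1 i) (x1 j).
Proof.
pose N := (maxn i j).+1; have iN : (i < N.*2)%N by rewrite /N; lia.
have jN : (j < N.*2)%N by rewrite /N; lia.
have [_ _ /(_ _ _ (definable_ndist (leqnn _) iN jN))] := matched12 N.
by rewrite !nth_mkseq.
Qed.

(** One integrand for two purposes: [a = 1], [b = 0] gives measures of boxes, and [a = 0], [b = 1]
    gives integrals of the kernel over rectangles of boxes. *)
Definition box_integrand d (J : measurableType d) (K : ternary_kernel J R) (x : nat -> J)
    (a b : R) j (u v : J -> R) (p : J * J) :=
  (a + b * K (x j, p.1, p.2)) * (u p.1 * v p.2).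

Lemma definable_bump k s n v : (forall q, q \in s -> (q.1 < n)%N) ->
  (v < n.+2)%N ->
  definable K1 K2 n n.+2 (fun x => bump K1 k s (nth point x) (nth point x v))
                         (fun x => bump K2 k s (nth point x) (nth point x v)).
Proof.
move=> sn vn; apply: definable_prod => q qs; have qn := sn _ qs.
apply: definable_min; first exact: definable_cst.
apply: definableZ; apply: definable_max; first exact: definable_cst.
apply: definableB; first exact: definable_cst.
by apply: definable_ndist => //; rewrite ?(leq_trans qn) ?leqW.
Qed.

Lemma box_integrandE d (J : measurableType d) (K : ternary_kernel J R) (x : nat -> J)
    (a b : R) j k s s' n y z :
  (forall q, q \in s -> (q.1 < n)%N) -> (forall q, q \in s' -> (q.1 < n)%N) -> (j < n)%N ->
  let l := rcons (rcons (mkseq x n) y) z in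
  (a + b * entry K l (j, n, n.+1)) * (bump K k s (nth point l) (nth point l n) *
    bump K k s' (nth point l) (nth point l n.+1)) =
  box_integrand K x a b j (bump K k s x) (bump K k s' x) (y, z).
Proof.
move=> sn sn' jn l.
have lx i : (i < n)%N -> nth point l i = x i.
  by move=> ni; rewrite /l !nth_rcons size_rcons size_mkseq ltnS (ltnW ni) ni nth_mkseq.
have ly : nth point l n = y by rewrite /l !nth_rcons size_rcons size_mkseq ltnSn ltnn eqxx.
have lz : nth point l n.+1 = z by rewrite /l nth_rcons size_rcons size_mkseq ltnn eqxx.
rewrite /box_integrand /entry /= ly lz lx//; congr (_ * (_ * _)).
  by apply: eq_big_seq => q qs; rewrite lx// sn.
by apply: eq_big_seq => q qs; rewrite lx// sn'.
Qed.

Lemma bump_integral a b j k s s' :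
  [/\ bounded_measurable (box_integrand K1 x1 a b j (bump K1 k s x1) (bump K1 k s' x1)),
      bounded_measurable (box_integrand K2 x2 a b j (bump K2 k s x2) (bump K2 k s' x2)) &
  \int[(kmu K1 \x kmu K1)%E]_p box_integrand K1 x1 a b j (bump K1 k s x1) (bump K1 k s' x1) p =
  \int[(kmu K2 \x kmu K2)%E]_p box_integrand K2 x2 a b j (bump K2 k s x2) (bump K2 k s' x2) p].
Proof.
(* The length [n] is even, as in [matched12], and exceeds [j] and the indices of all centers. *)
pose m := \max_(q <- s ++ s') q.1; pose N := (maxn j m).+1; pose n := N.*2.
have jn : (j < n)%N by rewrite /n /N; lia.
have qn q : q \in s ++ s' -> (q.1 < n)%N.
  move=> qs; have : (q.1 <= m)%N by exact: (@leq_bigmax_seq _ _ predT (fun q : nat * R => q.1)).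
  by rewrite /n /N; case: q {qs} => i r /=; lia.
have sn q : q \in s -> (q.1 < n)%N by move=> qs; apply: qn; rewrite mem_cat qs.
have sn' q : q \in s' -> (q.1 < n)%N by move=> qs; apply: qn; rewrite mem_cat qs orbT.
have dent : definable K1 K2 n n.+2 (fun x => entry K1 x (j, n, n.+1))
                                   (fun x => entry K2 x (j, n, n.+1)).
  by apply: definable_entry; lia.
have df := definableM (definableD (definable_cst _ _ _ _ a) (definableZ b dent))
  (definableM (definable_bump k sn (leqnSn _)) (definable_bump k sn' (leqnn _))).
have [b1 b2 _] := df.
have {}b1 := lmeas_rcons2 (size_mkseq x1 n) b1.
have {}b2 := lmeas_rcons2 (size_mkseq x2 n) b2.
have E1 := box_integrandE K1 x1 a b k _ _ sn sn' jn.
have E2 := box_integrandE K2 x2 a b k _ _ sn sn' jn.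
have {}b1 : bounded_measurable (box_integrand K1 x1 a b j (bump K1 k s x1) (bump K1 k s' x1)).
  by apply: (eq_ind _ (@bounded_measurable R _ (J1 * J1)%type) b1); apply/funext => -[y z]; exact: E1.
have {}b2 : bounded_measurable (box_integrand K2 x2 a b j (bump K2 k s x2) (bump K2 k s' x2)).
  by apply: (eq_ind _ (@bounded_measurable R _ (J2 * J2)%type) b2); apply/funext => -[y z]; exact: E2.
split => //; rewrite !bmeas_fubini1//.
have [_ _ /(_ _ _ (definable_Rintegral (definable_Rintegral df))) m12] := matched12 N.
by etransitivity; last (etransitivity; first exact: m12);
  apply: eq_Rintegral => y _; apply: eq_Rintegral => z _; rewrite -?E1 -?E2.
Qed.

Lemma bump_integral_cvg d (J : measurableType d) (K : ternary_kernel J R) (x : nat -> J)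
    a b j s s' :
  (forall k, bounded_measurable (box_integrand K x a b j (bump K k s x) (bump K k s' x))) ->
  (fun k => \int[(kmu K \x kmu K)%E]_p
    box_integrand K x a b j (bump K k s x) (bump K k s' x) p) @ \oo -->
  \int[(kmu K \x kmu K)%E]_p
    box_integrand K x a b j \1_(box K x s) \1_(box K x s') p.
Proof.
move=> bk; have [M KM] := kernel_bound K.
apply: (@bmeas_dominated _ _ _ (kmu K \x kmu K)%E _ _ (`|a| + `|b| * M) _ _ _).2.
- by move=> k; have [] := bk k.
- move=> k p; rewrite /box_integrand normrM -[leRHS]mulr1 ler_pM//.
    rewrite (le_trans (ler_normD _ _))// lerD// normrM ler_wpM2l//.
  have /andP[u0 u1] := bump01 K k s x p.1; have /andP[v0 v1] := bump01 K k s' x p.2.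
  by rewrite ger0_norm ?mulr_ge0// mulr_ile1.
- move=> p; apply: cvg_near_cst.
  apply: filterS2 (bump_indic K s x p.1) (bump_indic K s' x p.2) => k h h'.
  by rewrite /box_integrand h h'.
Qed.

Lemma box_integral a b j s s' :
  \int[(kmu K1 \x kmu K1)%E]_p box_integrand K1 x1 a b j \1_(box K1 x1 s) \1_(box K1 x1 s') p =
  \int[(kmu K2 \x kmu K2)%E]_p box_integrand K2 x2 a b j \1_(box K2 x2 s) \1_(box K2 x2 s') p.
Proof.
have B k := bump_integral a b j k s s'.
have b1 k : bounded_measurable (box_integrand K1 x1 a b j (bump K1 k s x1) (bump K1 k s' x1)).
  by have [] := B k.
have b2 k : bounded_measurable (box_integrand K2 x2 a b j (bump K2 k s x2) (bump K2 k s' x2)).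
  by have [] := B k.
have c1 := bump_integral_cvg b1; have c2 := bump_integral_cvg b2.
have E : (fun k => \int[(kmu K1 \x kmu K1)%E]_p
    box_integrand K1 x1 a b j (bump K1 k s x1) (bump K1 k s' x1) p) =
    (fun k => \int[(kmu K2 \x kmu K2)%E]_p
    box_integrand K2 x2 a b j (bump K2 k s x2) (bump K2 k s' x2) p).
  by apply/funext => k; have [] := B k.
by rewrite E in c1; apply: cvg_unique c1 c2; exact: Rhausdorff.
Qed.

(** Taking the constant integrand and the whole space as second box reduces this to
    [box_integral]. *)
Lemma box_measure s : kmu K1 (box K1 x1 s) = kmu K2 (box K2 x2 s).
Proof.
have boxE d (J : measurableType d) (K : ternary_kernel J R) (x : nat -> J) :
    pure_kernel K -> (\int[(kmu K \x kmu K)%E]_p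
      box_integrand K x 1 0 0 \1_(box K x s) \1_(box K x [::]) p)%:E = kmu K (box K x s).
  move=> pK; have mB := measurable_box pK x s.
  rewrite -Rintegral_indicT//; congr EFin.
  have -> : \int[(kmu K \x kmu K)%E]_p
      box_integrand K x 1 0 0 \1_(box K x s) \1_(box K x [::]) p =
      \int[(kmu K \x kmu K)%E]_p (\1_(box K x s) p.1 : R).
    by apply: eq_Rintegral => p _; rewrite /box_integrand mul0r addr0 mul1r box_nil indicT mulr1.
  rewrite bmeas_fubini1; last by apply: bmeas_comp (bmeas_indic mB).
  by apply: eq_Rintegral => y _; exact: (@RintegralT_cst _ _ _ (kmu K) (\1_(box K x s) y)).
by rewrite -!boxE// box_integral.
Qed.

End BoxLaw.

(** * Equality of the measures and of the kernels *)

Section MeasurePreserving.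
Context {R : realType} d1 d2 (J1 : measurableType d1) (J2 : measurableType d2).

Lemma measure_preserving_measurable (m1 : probability J1 R) (m2 : probability J2 R)
    (rho : J1 -> J2) : measure_preserving m1 m2 rho -> measurable_fun setT rho.
Proof. by move=> mp _ A mA; rewrite setTI; have [] := mp A mA. Qed.

Lemma Rintegral_measure_preserving (m1 : probability J1 R) (m2 : probability J2 R)
    (rho : J1 -> J2) (h : J2 -> R) : measure_preserving m1 m2 rho ->
  bounded_measurable h -> \int[m2]_y h y = \int[m1]_x h (rho x).
Proof.
move=> mp bh; have mrho := measure_preserving_measurable mp.
have bhr : bounded_measurable (fun x => h (rho x)) by exact: bmeas_comp bh.
pose rhoM := HB.pack_for {mfun J1 >-> J2} rho (isMeasurableFun.Build _ _ _ _ _ mrho).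
transitivity (\int[distribution m1 rhoM]_y h y); congr fine.
  by apply: eq_measure_integral => A mA _; have [_] := mp _ mA.
rewrite integral_distribution//; first by apply/measurable_EFinP; case: bh.
exact: (@bmeas_integrable _ _ _ m1 _ bhr).
Qed.

Lemma Rintegral_measure_preserving2 (m1 : probability J1 R) (m2 : probability J2 R)
    (rho : J1 -> J2) (h : J2 * J2 -> R) : measure_preserving m1 m2 rho ->
  bounded_measurable h ->
  \int[(m2 \x m2)%E]_p h p = \int[(m1 \x m1)%E]_p h (rho p.1, rho p.2).
Proof.
move=> mp bh; have mrho := measure_preserving_measurable mp.
have bhr : bounded_measurable (fun p : J1 * J1 => h (rho p.1, rho p.2)).
  apply: bmeas_comp bh; apply: measurable_fun_pair; exact: measurableT_comp.
rewrite !bmeas_fubini1//.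
rewrite (Rintegral_measure_preserving mp); last exact: bmeas_Rintegral.
apply: eq_Rintegral => x _.
by rewrite (Rintegral_measure_preserving mp)//; exact: bmeas_section1.
Qed.

Context (K1 : ternary_kernel J1 R) (K2 : ternary_kernel J2 R).
Variables (x1 : nat -> J1) (x2 : nat -> J2) (rho : J1 -> J2).
Hypotheses (pureK1 : pure_kernel K1) (pureK2 : pure_kernel K2).
Hypothesis dense2 : forall z (e : R), 0 < e -> exists j, ndist K2 (x2 j) z < e.
Hypothesis rhoP : forall z, corresponding K1 K2 x1 x2 z (rho z).

Lemma preimage_box s : rho @^-1` (box K2 x2 s) = box K1 x1 s.
Proof.
by apply/seteqP; split => z h q /h; rewrite rhoP.
Qed.

(** The image of the first measure and the second measure agree on boxes, a pi-system that generates
    the measurable sets. *)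
Lemma corresponding_measure_preserving :
  (forall s, kmu K1 (box K1 x1 s) = kmu K2 (box K2 x2 s)) ->
  measure_preserving (kmu K1) (kmu K2) rho.
Proof.
move=> same; have gen := measurable_gen_box pureK2 dense2.
have mrho : measurable_fun setT rho.
  apply: (@measurability _ _ J1 J2 _ _ _ gen) => _ [_ [s _ <-] <-].
  by rewrite setTI preimage_box; exact: measurable_box.
move=> A mA; split; first by rewrite -[X in measurable X]setTI; exact: mrho.
pose rhoM := HB.pack_for {mfun J1 >-> J2} rho (isMeasurableFun.Build _ _ _ _ _ mrho).
apply: (@g_sigma_algebra_measure_unique _ _ _ (range (box K2 x2)) _ (fun=> setT)
  _ _ (distribution (kmu K1) rhoM) (kmu K2)).
- by rewrite gen; exact: sub_sigma_algebra.
- by move=> _; exists [::]; rewrite // box_nil.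
- by apply/seteqP; split => // x _; exists 0%N.
- exact: range_box_setI.
- by move=> _ [s _ <-]; exact: etrans (congr1 (kmu K1) (preimage_box s)) (same s).
- by move=> _; rewrite (le_lt_trans (probability_le1 _ _))// ltry.
- by rewrite -gen.
Qed.

End MeasurePreserving.

Section KernelIsomorphism.
Context {R : realType} d1 d2 (J1 : measurableType d1) (J2 : measurableType d2).
Context (K1 : ternary_kernel J1 R) (K2 : ternary_kernel J2 R).
Variables (x1 : nat -> J1) (x2 : nat -> J2) (rho : J1 -> J2).
Hypotheses (pureK1 : pure_kernel K1) (pureK2 : pure_kernel K2).
Hypothesis dense1 : forall z (e : R), 0 < e -> exists j, ndist K1 (x1 j) z < e.
Hypothesis rhoP : forall z, corresponding K1 K2 x1 x2 z (rho z).
Hypothesis rho_mp : measure_preserving (kmu K1) (kmu K2) rho.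
Hypothesis box_eq : forall a b j s s',
  \int[(kmu K1 \x kmu K1)%E]_p
    box_integrand K1 x1 a b j \1_(box K1 x1 s) \1_(box K1 x1 s') p =
  \int[(kmu K2 \x kmu K2)%E]_p
    box_integrand K2 x2 a b j \1_(box K2 x2 s) \1_(box K2 x2 s') p.
Local Notation mu2 := (kmu K1 \x kmu K1)%E.

Lemma bmeas_kernel_section d (J : measurableType d) (K : ternary_kernel J R) a :
  bounded_measurable (fun p : J * J => K (a, p.1, p.2)).
Proof.
have [M KM] := kernel_bound K; split; last by exists M => p; exact: KM.
apply: (measurableT_comp (kfun_measurable K)); apply: measurable_fun_pair => //.
exact: measurable_fun_pair.
Qed.

Lemma bmeas_pullback_section a :
  bounded_measurable (fun p : J1 * J1 => K2 (a, rho p.1, rho p.2)).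
Proof.
have mrho := measure_preserving_measurable rho_mp.
apply: (@bmeas_comp _ _ _ _ _ (fun p => (rho p.1, rho p.2)) _ _
  (bmeas_kernel_section K2 a)).
by apply: measurable_fun_pair; exact: measurableT_comp.
Qed.

(** Both functions have the same integral over every rectangle of boxes: [box_eq] compares the
    kernels, and [rho] transports the integral to [J1], pulling boxes back to boxes. *)
Lemma section_eq_at_sequence j :
  \int[mu2]_p `|K1 (x1 j, p.1, p.2) - K2 (x2 j, rho p.1, rho p.2)| = 0.
Proof.
have b1 := bmeas_kernel_section K1 (x1 j); have b2 := bmeas_pullback_section (x2 j).
apply: (Rintegral_rectangles_eq0 pureK1 dense1
  (h := fun p => K1 (x1 j, p.1, p.2) - K2 (x2 j, rho p.1, rho p.2))).
  exact: bmeasB.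
move=> s s'.
have bI : bounded_measurable (\1_(box K1 x1 s `*` box K1 x1 s') : J1 * J1 -> R).
  by apply: bmeas_indic; apply: measurableX; exact: measurable_box.
under eq_Rintegral do rewrite mulrBl.
rewrite bmeas_RintegralB; [|exact: bmeasM|exact: bmeasM].
apply/eqP; rewrite subr_eq0; apply/eqP.
have indX (T : Type) (A B : set T) p : \1_(A `*` B) p = \1_A p.1 * \1_B p.2 :> R.
  by rewrite !indicE in_setX; case: (_ \in _); case: (_ \in _); rewrite ?mulr0 ?mulr1.
transitivity (\int[mu2]_p
    box_integrand K1 x1 0 1 j \1_(box K1 x1 s) \1_(box K1 x1 s') p).
  by apply: eq_Rintegral => p _; rewrite /box_integrand add0r mul1r indX.
rewrite box_eq (Rintegral_measure_preserving2 rho_mp).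
  apply: eq_Rintegral => p _; rewrite /box_integrand add0r mul1r indX/=.
  by congr (_ * (_ * _)); rewrite -(preimage_box rhoP) !indicE; congr (nat_of_bool _)%:R;
    apply/idP/idP; rewrite !inE.
apply: bmeasM; first apply: bmeasD; first exact: bmeas_cst.
  by apply: bmeasM; [exact: bmeas_cst|exact: bmeas_kernel_section].
apply: bmeasM.
- by apply: (@bmeas_comp _ _ _ _ _ fst) => //; apply: bmeas_indic; exact: measurable_box.
- by apply: (@bmeas_comp _ _ _ _ _ snd) => //; apply: bmeas_indic; exact: measurable_box.
Qed.

(** Replacing [x] by a nearby [x1 j], and [rho x] by [x2 j], costs less than e/2 on each side, as
    [rho x] is as close to [x2 j] as [x] is to [x1 j]. *)
Lemma section_eq x :
  \int[mu2]_p `|K1 (x, p.1, p.2) - K2 (rho x, rho p.1, rho p.2)| = 0.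
Proof.
apply/eqP; rewrite eq_le; apply/andP; split; last exact: Rintegral_ge0.
apply/ler_addgt0Pr => e e0; rewrite add0r; have e20 : 0 < e / 2 by rewrite divr_gt0.
have [j jx] := dense1 x e20.
have jrx : ndist K2 (x2 j) (rho x) < e / 2 by rewrite rhoP.
rewrite /ndist (Rintegral_measure_preserving2 rho_mp) in jrx; last exact: bmeas_section_dist.
rewrite /ndist in jx.
have bK1 a := bmeas_kernel_section K1 a; have bK2 a := bmeas_pullback_section a.
have bA : bounded_measurable (fun p => `|K1 (x1 j, p.1, p.2) - K1 (x, p.1, p.2)|).
  exact: bmeas_section_dist.
have bB : bounded_measurable (fun p => `|K1 (x1 j, p.1, p.2) - K2 (x2 j, rho p.1, rho p.2)|).
  by apply: bmeas_abs; exact: bmeasB.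
have bC : bounded_measurable
    (fun p => `|K2 (x2 j, rho p.1, rho p.2) - K2 (rho x, rho p.1, rho p.2)|).
  by apply: bmeas_abs; exact: bmeasB.
apply: (@le_trans _ _ (\int[mu2]_p (`|K1 (x1 j, p.1, p.2) - K1 (x, p.1, p.2)| +
  `|K1 (x1 j, p.1, p.2) - K2 (x2 j, rho p.1, rho p.2)| +
  `|K2 (x2 j, rho p.1, rho p.2) - K2 (rho x, rho p.1, rho p.2)|))).
  apply: bmeas_le.
  - by apply: bmeas_abs; exact: bmeasB.
  - by apply: bmeasD => //; exact: bmeasD.
  - move=> p; rewrite (distrC (K1 (x1 j, p.1, p.2)) (K1 (x, p.1, p.2))).
    rewrite (le_trans (ler_distD (K2 (x2 j, rho p.1, rho p.2)) _ _))// lerD2r.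
    exact: ler_distD.
rewrite bmeas_RintegralD//; last exact: bmeasD.
by rewrite bmeas_RintegralD// section_eq_at_sequence addr0 [leRHS]splitr lerD// ltW.
Qed.

Lemma pullback_ae_eq : {ae (kmu K1 \x kmu K1 \x kmu K1)%E,
  forall p : J1 * J1 * J1, K1 p = pullback rho K2 p}.
Proof.
have mrho := measure_preserving_measurable rho_mp.
pose f (p : J1 * J1 * J1) := K1 p - pullback rho K2 p.
have bf : bounded_measurable f.
  have [M1 KM1] := kernel_bound K1; have [M2 KM2] := kernel_bound K2.
  apply: bmeasB; first by split; [exact: kfun_measurable|exists M1].
  split; last by exists M2 => p; exact: KM2.
  apply: (measurableT_comp (kfun_measurable K2)).
  apply: measurable_fun_pair; last exact: measurableT_comp.
  apply: measurable_fun_pair; apply: measurableT_comp => //;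
    exact: measurableT_comp.
have bfa := bmeas_abs bf.
have f0 : \int[(kmu K1 \x kmu K1 \x kmu K1)%E]_p `|f p| = 0.
  (* With the first variable outermost, the inner double integral is the one of [section_eq], which
     vanishes for every [x]. *)
  rewrite (@bmeas_fubini1 _ _ _ _ _ (kmu K1 \x kmu K1)%E (kmu K1) (fun p => `|f p|))//.
  rewrite bmeas_fubini1; last exact: (bmeas_Rintegral (kmu K1 \x kmu K1)%E (kmu K1) bfa).
  rewrite -[RHS](RintegralT_cst (kmu K1)); apply: eq_Rintegral => x _.
  rewrite -(section_eq x) bmeas_fubini1//.
  by apply: bmeas_abs; apply: bmeasB; [exact: bmeas_kernel_section|exact: bmeas_pullback_section].
have : ae_eq (kmu K1 \x kmu K1 \x kmu K1)%E setT (EFin \o f) (cst 0%E).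
  apply/ae_eq_integral_abs => //; first by apply/measurable_EFinP; case: bf.
  by rewrite -[RHS](congr1 EFin f0) (@bmeas_EFin _ _ _ (kmu K1 \x kmu K1 \x kmu K1)%E).
apply: filterS => p /(_ I) /= [] /eqP; rewrite subr_eq0 => /eqP.
exact.
Qed.

End KernelIsomorphism.

Theorem theorem24 (R : realType)
    (d1 : measure_display) (J1 : measurableType d1) (K1 : ternary_kernel J1 R)
    (d2 : measure_display) (J2 : measurableType d2) (K2 : ternary_kernel J2 R)
    (pureK1 : pure_kernel K1) (pureK2 : pure_kernel K2)
    (sameK : same_sampling K1 K2) :
  exists (rho : J1 -> J2) (rhoV : J2 -> J1),
    [/\ cancel rho rhoV /\ cancel rhoV rho,
        forall x y : J1, ndist K2 (rho x) (rho y) = ndist K1 x y,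
        measure_preserving (kmu K1) (kmu K2) rho,
        measure_preserving (kmu K2) (kmu K1) rhoV &
        {ae (kmu K1 \x kmu K1 \x kmu K1)%E,
          forall p : J1 * J1 * J1, K1 p = pullback rho K2 p}].
Proof.
have [x1 [x2 [m12 dense1 dense2]]] := dense_matched_sequences pureK1 pureK2 sameK.
have iso := matched_ndist m12.
have iso' i j : ndist K1 (x1 i) (x1 j) = ndist K2 (x2 i) (x2 j) by rewrite iso.
have /choice[rho rhoP] := corresponding_exists pureK2 dense1 iso.
(* The inverse comes from the same construction with the kernels exchanged. *)
have /choice[rhoV rhoVP] := corresponding_exists pureK1 dense2 iso'.
have same_box s := box_measure pureK1 pureK2 m12 s.
have rho_mp := corresponding_measure_preserving pureK1 pureK2 dense2 rhoP same_box.
have rhoV_mp := corresponding_measure_preserving pureK2 pureK1 dense1 rhoVP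
  (fun s => esym (same_box s)).
have [sep1 _ _ _ _] := pureK1; have [sep2 _ _ _ _] := pureK2.
exists rho, rhoV; split => //.
(* A point and its image under the round trip correspond to the same point, hence are at distance 0,
   and [ndist] separates points. *)
- split => z; apply/esym.
    apply: sep1; rewrite (corresponding_ndist dense2 (corresponding_sym (rhoP z)) (rhoVP _)).
    exact: ndistxx.
  apply: sep2; rewrite (corresponding_ndist dense1 (corresponding_sym (rhoVP z)) (rhoP _)).
  exact: ndistxx.
- by move=> x y; exact: (corresponding_ndist dense1 (rhoP x) (rhoP y)).
- by apply: (pullback_ae_eq pureK1 pureK2 dense1 rhoP rho_mp) => a b j s s'; exact: box_integral.
Qed.
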